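(* For $i=1,2,3$ let $G_i$ be an $r_i$-regular graph with $n_i\ge1$ vertices and $m_i$ edges, where $G_1$ is connected and $r_1\ge1$. Let $\theta_i$ ($1\le i\le n_1$), $\mu_j$ ($1\le j\le n_2$), $\eta_k$ ($1\le k\le n_3$) be the eigenvalues of $\mathcal L(G_1)$, $\mathcal L(G_2)$, $\mathcal L(G_3)$, respectively, each listed in non-increasing order with multiplicity (so $\theta_{n_1}=\mu_{n_2}=\eta_{n_3}=0$). Let $\mathcal G=G_1^S\bowtie(G_2^V\cup G_3^E)$ and $\mathfrak G=G_1^S\diamondsuit(G_2^V\cup G_3^E)$. Then (1) $$Kf^*(\mathcal G)=2(2m_1+n_1m_2+m_1m_3+2m_1n_2+m_1n_3)\Big(\sum_{j=1}^{n_2-1}\tfrac{n_1(r_1+r_2)}{r_1+r_2\mu_j}+\sum_{k=1}^{n_3-1}\tfrac{m_1(r_3+1)}{1+r_3\eta_k}+\tfrac{(m_1-n_1)(r_3+2)(2n_2+n_3+2)}{2n_2+2}$$ $$+\tfrac{(2n_2+n_3+2)(6r_1+3r_2+3r_1r_3+r_2r_3)-n_3(r_1+r_2)-2(r_3+1)(r_1+r_2+r_1n_2)}{(4r_1+r_2+r_1r_3)(2n_2+n_3+2)-(2r_1n_3+r_2n_3+2r_2)-(2+2n_2)(2r_1+r_1r_3)}$$ $$+\sum_{i=1}^{n_1-1}\tfrac{(4r_1+r_2+r_1r_3)(2n_2+n_3+2)-n_3(2r_1+r_2)-(2-\theta_i)\left((1+n_2)(2r_1+r_1r_3)+r_2\right)}{r_1(1+n_2)\theta_i}\Big);$$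 (2) $$Kf^*(\mathfrak G)=2(2m_1+m_1m_2+n_1m_3+n_1n_3+2m_1n_2)\Big(\sum_{j=1}^{n_2-1}\tfrac{m_1(r_2+2)}{2+r_2\mu_j}+\sum_{k=1}^{n_3-1}\tfrac{n_1(r_3+1)}{1+r_3\eta_k}+\tfrac{(r_2+4)(m_1-n_1)}{2}$$ $$+\tfrac{2(r_1n_2+r_1+n_3)(r_2r_3+6r_3+3r_2+12)-n_3(2r_2+4)-2r_1(r_3+1)(2n_2+r_2+2)}{2n_2r_1r_2+8n_2r_1+4n_3r_3+8n_3+8r_1}$$ $$+\sum_{i=1}^{n_1-1}\tfrac{2(r_1n_2+r_1+n_3)(2r_3+r_2+8)-(2r_2n_3+8n_3)-r_1(2-\theta_i)\left((2+2n_2)(2+r_3)+r_2\right)}{r_1(2+2n_2)\theta_i}\Big).$$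
   Context: All graphs are finite, simple and undirected. The normalized Laplacian matrix of $G$ is $\mathcal L(G)=I-D(G)^{-1/2}A(G)D(G)^{-1/2}$, where $A(G)$ is the adjacency matrix and $D(G)$ the diagonal degree matrix; rows and columns of $\mathcal L(G)$ indexed by isolated vertices are taken to be zero (e.g. $\mathcal L(K_1)=(0)$). The multiplicative degree-Kirchhoff index of a connected graph $G$ is $Kf^*(G)=\sum_{i<j}d_id_jr_{ij}$, where $d_i$ is the degree of vertex $i$ and $r_{ij}$ is the effective resistance between vertices $i$ and $j$ (each edge being a unit resistor). It is known (Chen and Zhang) that for a connected graph with $n$ vertices, $m$ edges and normalized Laplacian eigenvalues $\lambda_1\ge\dots\ge\lambda_{n-1}>\lambda_n=0$ one has $Kf^*(G)=2m\sum_{i=1}^{n-1}\frac1{\lambda_i}$. The subdivision graph $S(G_1)$ is obtained by inserting a new vertex into every edge of $G_1$; its vertex set is $V(G_1)\cup I(G_1)$, where $I(G_1)$ is the set of inserted vertices, in bijection with the edges of $G_1$. The graph $G_1^S\bowtie(G_2^V\cup G_3^E)$ (subdivision vertex-edge neighbourhood vertex-corona) consists of $S(G_1)$, $|V(G_1)|$ copies of $G_2$ and $|I(G_1)|$ copies of $G_3$, all vertex-disjoint, where for each $i$ every neighbour in $S(G_1)$ of the $i$-th vertex of $V(G_1)$ is joined to every vertex of the $i$-th copy of $G_2$, and for each $i$ the $i$-th vertex of $I(G_1)$ is joined to every vertex of the $i$-th copy of $G_3$. The graph $G_1^S\diamondsuit(G_2^V\cup G_3^E)$ (subdivision vertex-edge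 neighbourhood edge-corona) consists of $S(G_1)$, $|I(G_1)|$ copies of $G_2$ and $|V(G_1)|$ copies of $G_3$, all vertex-disjoint, where for each $i$ every neighbour in $S(G_1)$ of the $i$-th vertex of $I(G_1)$ is joined to every vertex of the $i$-th copy of $G_2$, and for each $i$ the $i$-th vertex of $V(G_1)$ is joined to every vertex of the $i$-th copy of $G_3$. *)

(* Defs.v *)
From HB Require Import structures.
From mathcomp Require Import all_boot all_order all_algebra.

Set Implicit Arguments.
Unset Strict Implicit.
Unset Printing Implicit Defensive.

Import Order.TTheory GRing.Theory Num.Theory.

(* The scalars are an arbitrary real closed field R, e.g. the real numbers. *)

Record sgraph := SGraph {
  vertex :> finType;
  adj : rel vertex;
  adj_sym : symmetric adj;
  adj_irr : irreflexive adj }.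

Definition edges (G : sgraph) : {set {set G}} :=
  [set E : {set G} | [exists x, exists y, adj x y && (E == [set x; y])]].

Definition neighbours (G : sgraph) (x : G) : {set G} := [set y | adj x y].

Definition degree (G : sgraph) (x : G) : nat := #|neighbours x|.

Definition regular (G : sgraph) (r : nat) : Prop :=
  forall x : G, degree x = r.

Definition connected (G : sgraph) : Prop :=
  forall x y : G, connect (@adj G) x y.

Section Matrices.
Local Open Scope ring_scope.
Variables (R : rcfType) (G : sgraph).

Let vtx (i : 'I_#|G|) : G := enum_val i.

Definition adjacency_mx : 'M[R]_#|G| :=
  \matrix_(i, j) (adj (vtx i) (vtx j))%:R.

Definition degree_mx : 'M[R]_#|G| :=
  diag_mx (\row_i (degree (vtx i))%:R).

(* D^{-1/2}; its entry at an isolated vertex is 0 because 0^-1 = 0. *)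
Definition degree_isqrt_mx : 'M[R]_#|G| :=
  diag_mx (\row_i (Num.sqrt (degree (vtx i))%:R)^-1).

(* The first term is the identity with the isolated vertices zeroed out. *)
Definition normalized_laplacian : 'M[R]_#|G| :=
  diag_mx (\row_i (0 < degree (vtx i))%N%:R)
    - degree_isqrt_mx *m adjacency_mx *m degree_isqrt_mx.

Definition laplacian : 'M[R]_#|G| := degree_mx - adjacency_mx.

(* A potential v under which a unit current enters at i and leaves at j, every
   edge being a unit resistor: Kirchhoff's law reads
   v *m laplacian = delta_mx 0 i - delta_mx 0 j.  This is solvable when G is
   connected, and then pinvmx returns a solution (mulmxKpV); two solutions
   differ by a constant vector. *)
Definition unit_current_potential (i j : 'I_#|G|) : 'rV[R]_#|G| :=
  (delta_mx 0 i - delta_mx 0 j) *m pinvmx laplacian.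

Definition effective_resistance (i j : 'I_#|G|) : R :=
  unit_current_potential i j 0 i - unit_current_potential i j 0 j.

Definition degree_kirchhoff : R :=
  \sum_(i < #|G|) \sum_(j < #|G| | (i < j)%N)
    (degree (vtx i))%:R * (degree (vtx j))%:R * effective_resistance i j.

End Matrices.

(* s lists the eigenvalues of A, with algebraic multiplicity, in
   non-increasing order. *)
Definition spectrum_of (R : rcfType) (n : nat) (A : 'M[R]_n) (s : seq R) :
    Prop :=
  sorted >=%R s /\ char_poly A = (\prod_(x <- s) ('X - x%:P))%R.

Section Subdivision.
Variable G : sgraph.

Definition inserted : finType := {E : {set G} | E \in edges G}.

Definition subdivision_adj (a b : G + inserted) : bool :=
  match a, b with
  | inl x, inr E => x \in val E
  | inr E, inl x => x \in val E
  | _, _ => false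
  end.

Fact subdivision_sym : symmetric subdivision_adj.
Proof. by case=> a [] b. Qed.

Fact subdivision_irr : irreflexive subdivision_adj.
Proof. by case. Qed.

Definition subdivision : sgraph := SGraph subdivision_sym subdivision_irr.

End Subdivision.

(* S together with a copy of H for each i : I and a copy of K for each j : J,
   all disjoint; every vertex of M i is joined to the whole i-th copy of H and
   every vertex of N j to the whole j-th copy of K. *)
Section AttachCopies.
Variables (S : sgraph) (I : finType) (M : I -> {set S}) (H : sgraph)
  (J : finType) (N : J -> {set S}) (K : sgraph).

Definition attach_adj (a b : S + (I * H + J * K)) : bool :=
  match a, b with
  | inl s, inl t => adj s t
  | inl s, inr (inl (i, _)) | inr (inl (i, _)), inl s => s \in M i
  | inl s, inr (inr (j, _)) | inr (inr (j, _)), inl s => s \in N j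
  | inr (inl (i, x)), inr (inl (i', y)) => (i == i') && adj x y
  | inr (inr (j, x)), inr (inr (j', y)) => (j == j') && adj x y
  | _, _ => false
  end.

Fact attach_sym : symmetric attach_adj.
Proof.
case=> [s|[[i x]|[j x]]] [t|[[i' y]|[j' y]]] //=.
- exact: adj_sym.
- by rewrite eq_sym adj_sym.
- by rewrite eq_sym adj_sym.
Qed.

Fact attach_irr : irreflexive attach_adj.
Proof. by case=> [s|[[i x]|[j x]]] /=; rewrite adj_irr ?andbF. Qed.

Definition attach : sgraph := SGraph attach_sym attach_irr.

End AttachCopies.

(* The graph written G1^S \bowtie (G2^V \cup G3^E). *)
Definition vertex_corona (G1 G2 G3 : sgraph) : sgraph :=
  @attach (subdivision G1)
    G1 (fun v => @neighbours (subdivision G1) (inl v)) G2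
    (inserted G1) (fun E => [set inr E]) G3.

(* The graph written G1^S \diamondsuit (G2^V \cup G3^E). *)
Definition edge_corona (G1 G2 G3 : sgraph) : sgraph :=
  @attach (subdivision G1)
    (inserted G1) (fun E => @neighbours (subdivision G1) (inr E)) G2
    G1 (fun v => [set inl v]) G3.

(* Main.v *)
Require Import Defs.
From mathcomp Require Import all_boot all_order all_algebra ring lra.

Set Implicit Arguments.
Unset Strict Implicit.
Unset Printing Implicit Defensive.

Import Order.TTheory GRing.Theory Num.Theory.
Local Open Scope ring_scope.

(** The degree-Kirchhoff index is a quadratic expression in the potentials, so
it can be read off any matrix X which inverts the Laplacian L up to
constants, X L = 1 - 1 w: the resistance between i and j is
X_ii + X_jj - X_ij - X_ji, hence Kf* = (sum d) tr (D X) - d X d^T, where d is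
the row of degrees and D their diagonal matrix ([degree_kirchhoff_ginv]).  The
proof builds such an X for both coronas, and never computes their spectra.

Both graphs have the same shape.  Let C be one side of the subdivision graph
and T the other one.  Each t in T carries a copy of a graph H joined to the
neighbours of t, and each c in C a copy of a graph K joined to c; the first
corona has C = I(G1), the second C = V(G1).  Removing C disconnects
everything into small pieces: single vertices of T, copies of H, copies of K.
Eliminating the pieces, that is, taking a Schur complement, leaves on C the
weighted Laplacian (1 + #|H|) (l - N / k), where N c c' counts the common
neighbours of c and c' and k, l are the degrees in the bipartite graph.  All
vertices of a piece have the same k (or 1) neighbours in C, so the harmonic
measure h seen from any of them is uniform on those neighbours.  The matrix
X = g + h Y h^T then inverts L up to constants, where g is the Green kernel of
the pieces and Y a pseudo-inverse of that Schur complement ([schur_ginv]).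
Since Y kills constants and d h is constant on C, d X d^T only sees g, while
tr (D X) reduces to the traces of g and Y ([degree_kirchhoff_bicorona]).

The trace of g comes from the resolvents (k + L_H)^-1 and (1 + L_K)^-1, whose
spectra are those of H and K because L = r * (normalized Laplacian) on an
r-regular graph ([green_kernel]).  As for Y, it is enough to pseudo-invert
l - N / k and to divide by 1 + #|H|.  If Z is the pseudo-inverse of
L_G1, whose trace is the sum of the 1 / (r1 theta_i)
([pseudo_inverse_kernel]), then 2 Z works on the vertex side because
B B^T = 2 r1 - L_G1 for the incidence matrix B, and (1 + B^T Z B - J / m1) / 2
works on the edge side, J being the matrix of ones ([vertex_side_inverse],
[edge_side_inverse]).  The identities of the theorem follow by clearing
denominators, with 2 m_i = n_i r_i. *)

(** * Finite sums *)

Section FiniteSums.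
Variables (R : pzSemiRingType) (T : finType).

Lemma sum_delta (x : T) (F : T -> R) : \sum_y (x == y)%:R * F y = F x.
Proof.
rewrite (bigD1 x) //= eqxx mul1r big1 ?addr0 // => y.
by rewrite eq_sym => /negPf->; rewrite mul0r.
Qed.

Lemma sum_delta1 (x : T) : \sum_y (x == y)%:R = 1 :> R.
Proof.
by rewrite -[RHS](sum_delta x (fun=> 1)); apply: eq_bigr => y _; rewrite mulr1.
Qed.

Lemma sum_cst (c : R) : \sum_(x : T) c = #|T|%:R * c.
Proof. by rewrite sumr_const mulr_natl. Qed.

Lemma sum_pred (P : pred T) : \sum_x (P x)%:R = #|[set x | P x]|%:R :> R.
Proof.
rewrite -sum1_card natr_sum [RHS]big_mkcond /=.
by apply: eq_bigr => x _; rewrite inE; case: (P x).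
Qed.

End FiniteSums.

(** * Matrices whose characteristic polynomial splits *)

Lemma det_add_rank1 (R : comNzRingType) (n : nat)
    (u : 'cV[R]_n) (v : 'rV[R]_n) :
  \det (1%:M + u *m v) = 1 + (v *m u) 0 0.
Proof.
pose L (w : 'rV[R]_n) : 'M[R]_(n + 1) := block_mx 1%:M 0 w 1%:M.
have detL w : \det (L w) = 1 by rewrite det_lblock !det1 mulr1.
have /(congr1 (fun B => \det B)) :
    L v *m block_mx (1%:M + u *m v) u 0 1%:M *m L (- v)
    = block_mx 1%:M u 0 (1%:M + v *m u).
  rewrite !mulmx_block !mul1mx !mul0mx !mulmx1 !mulmx0 !addr0 !add0r.
  rewrite mulmxDl mul1mx !mulmxDr !mulmxN !mulmx1 mulmxA addrK.
  by congr block_mx; [rewrite -opprD [v + _]addrC subrr | rewrite addrC].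
rewrite !det_mulmx !detL mul1r mulr1 !det_ublock !det1 mulr1 mul1r => ->.
by rewrite det_mx11 !mxE.
Qed.

Definition splits (R : numFieldType) (n : nat) (A : 'M[R]_n) (s : seq R) :
    Prop :=
  char_poly A = \prod_(x <- s) ('X - x%:P).

Section SplitSpectra.
Variable R : numFieldType.
Implicit Types (s : seq R).

Lemma prodrMl (b : R) s (F : R -> R) :
  b ^+ size s * \prod_(x <- s) F x = \prod_(x <- s) (b * F x).
Proof.
elim: s => [|x s IHs]; first by rewrite !big_nil mulr1.
by rewrite !big_cons -IHs exprS; ring.
Qed.

Lemma horner_char_poly (n : nat) (A : 'M[R]_n) (t : R) :
  (char_poly A).[t] = \det (t%:M - A).
Proof.
rewrite -[LHS]/(horner_eval t (\det _)) -det_map_mx; congr (\det _).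
apply/matrixP=> i j; rewrite !mxE rmorphB rmorphMn /= /horner_eval.
by rewrite hornerX hornerC.
Qed.

Lemma horner_prod_XsubC s (t : R) :
  (\prod_(x <- s) ('X - x%:P)).[t] = \prod_(x <- s) (t - x).
Proof. by rewrite horner_prod; apply: eq_bigr => x _; rewrite hornerXsubC. Qed.

(** A relation between determinants which involves 1 / t is only available for
t != 0; this is enough, as the field is infinite. *)
Lemma eq_poly_nonzero (p q : {poly R}) :
  (forall t, t != 0 -> p.[t] = q.[t]) -> p = q.
Proof.
move=> pq; apply/eqP; rewrite -subr_eq0; apply/eqP.
pose rs := [seq i.+1%:R : R | i <- iota 0 (size (p - q))].
apply: (@roots_geq_poly_eq0 _ _ rs).
- apply/allP=> x /mapP[i _ ->]; rewrite rootE hornerD hornerN pq ?subrr //.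
  by rewrite pnatr_eq0.
- rewrite map_inj_uniq ?iota_uniq // => i j /eqP.
  by rewrite eqr_nat => /eqP[].
- by rewrite size_map size_iota.
Qed.

Lemma splits_nonzeroP (n : nat) (A : 'M[R]_n) s :
  (forall t, t != 0 -> \det (t%:M - A) = \prod_(x <- s) (t - x)) -> splits A s.
Proof.
move=> As; apply: eq_poly_nonzero => t t0.
by rewrite horner_char_poly horner_prod_XsubC As.
Qed.

Section Spectrum.
Variables (n : nat) (A : 'M[R]_n) (s : seq R).
Hypothesis As : splits A s.

Lemma splits_det (t : R) : \det (t%:M - A) = \prod_(x <- s) (t - x).
Proof. by rewrite -horner_char_poly As horner_prod_XsubC. Qed.

Lemma splits_size : size s = n.
Proof.
by apply: succn_inj; rewrite -(size_char_poly A) As size_prod_XsubC.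
Qed.

Lemma splits_trace : \tr A = \sum_(x <- s) x.
Proof.
have [s0|s_gt0] := posnP (size s).
  rewrite (size0nil s0) big_nil /mxtrace big1 // => i.
  by have := ltn_ord i; rewrite -{2}splits_size s0.
apply: oppr_inj; rewrite -char_poly_trace ?As -?splits_size //.
by rewrite coefPn_prod_XsubC // -lt0n.
Qed.

Lemma splits_affine (a b : R) :
  splits (a%:M + b *: A) [seq a + b * x | x <- s].
Proof.
apply: splits_nonzeroP => t _; rewrite big_map.
have [->|b0] := eqVneq b 0.
  rewrite scale0r addr0 -raddfB det_scalar -splits_size.
  have := prodrMl (t - a) s (fun=> 1); rewrite big1_eq mulr1 => ->.
  by apply: eq_bigr => x _; ring.
have -> : t%:M - (a%:M + b *: A) = b *: (((t - a) / b)%:M - A).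
  by rewrite scalerBr scale_scalar_mx mulrC divfK // raddfB /= opprD addrA.
rewrite detZ splits_det -splits_size prodrMl.
by apply: eq_bigr => x _; field.
Qed.

Lemma splits_det0 : \det A = \prod_(x <- s) x.
Proof.
have -> : A = -1 *: (0%:M - A) by rewrite raddf0 sub0r scaleN1r opprK.
rewrite detZ splits_det -splits_size prodrMl.
by apply: eq_bigr => x _; ring.
Qed.

Lemma splits_unitmx : (A \in unitmx) = (0 \notin s).
Proof.
rewrite unitmxE unitfE splits_det0 prodf_seq_eq0; congr negb.
by apply/hasP/idP => [[x xs /eqP<-]|s0] //; exists 0 => /=.
Qed.

Lemma splits_invmx : A \in unitmx -> splits (invmx A) [seq x^-1 | x <- s].
Proof.
move=> Au; have s0 := Au; rewrite splits_unitmx in s0.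
apply: splits_nonzeroP => t t0; rewrite big_map.
have tA : (t%:M - invmx A) *m A = - t *: ((t^-1)%:M - A).
  rewrite mulmxBl mul_scalar_mx mulVmx // scalerBr scale_scalar_mx.
  rewrite mulNr divff //.
  by rewrite scaleNr opprK addrC -raddfN.
apply: (@mulIf _ (\det A)); first by rewrite -unitfE -unitmxE.
rewrite -det_mulmx tA detZ splits_det splits_det0 -splits_size prodrMl.
rewrite -big_split /=.
rewrite big_seq [RHS]big_seq; apply: eq_bigr => x xs.
have x0 : x != 0 by apply: contraNneq s0 => <-.
by field; rewrite t0 x0.
Qed.

End Spectrum.

(** The spectrum of the inverse comes from t - A^-1 = - t A^-1 (1 / t - A),
and a trace is minus the second coefficient of the characteristic polynomial. *)
Lemma trace_invmx (n : nat) (A : 'M[R]_n) s :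
  splits A s -> A \in unitmx -> \tr (invmx A) = \sum_(x <- s) x^-1.
Proof.
by move=> As Au; rewrite (splits_trace (splits_invmx As Au)) big_map.
Qed.

(** Adding u v moves the eigenvalue of the null vector u from 0 to 1 and leaves
the rest of the spectrum alone, because
t - A - u v = (t - A) (1 - u v / t) when A u = 0. *)
Lemma splits_deflate (n : nat) (A : 'M[R]_n) s (u : 'cV[R]_n) (v : 'rV[R]_n) :
    splits A (0 :: s) -> A *m u = 0 -> v *m u = 1%:M ->
  splits (A + u *m v) (1 :: s).
Proof.
move=> As Au vu; apply: splits_nonzeroP => t t0.
have -> : t%:M - (A + u *m v) = (t%:M - A) *m (1%:M + (- t^-1 *: u) *m v).
  rewrite mulmxDr mulmx1 mulmxBl -scalemxAl mul_scalar_mx scalerA mulrN.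
  rewrite divff // -scalemxAr mulmxA Au mul0mx scaler0 subr0.
  by rewrite scaleN1r opprD addrA.
rewrite det_mulmx (splits_det As) det_add_rank1 -scalemxAr vu !mxE eqxx.
by rewrite !big_cons mulr1; field.
Qed.

End SplitSpectra.

(** * Laplacians of regular graphs *)

Section LaplacianKernel.
Variables (R : rcfType) (G : sgraph).
Implicit Types (x y z : G).

(** The Laplacian indexed by vertices rather than by ordinals, so that it can be
evaluated case by case on a disjoint union of vertex sets. *)
Definition lap x y : R := (degree x)%:R * (x == y)%:R - (adj x y)%:R.

Lemma natr_degree x : (degree x)%:R = \sum_y (adj x y)%:R :> R.
Proof.
by rewrite sum_pred.
Qed.

Lemma lapC x y : lap x y = lap y x.
Proof.
by rewrite /lap adj_sym eq_sym; case: eqVneq => [->|_] //; rewrite !mulr0.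
Qed.

Lemma sum_lap x : \sum_y lap x y = 0.
Proof.
rewrite sumrB -natr_degree -mulr_sumr.
by rewrite sum_delta1 mulr1 subrr.
Qed.

Lemma lap_form (u : G -> R) :
  \sum_x \sum_y u x * lap x y * u y
    = 2^-1 * \sum_x \sum_y (adj x y)%:R * (u x - u y) ^+ 2.
Proof.
have -> : \sum_x \sum_y u x * lap x y * u y
    = \sum_x \sum_y (adj x y)%:R * (u x ^+ 2 - u x * u y).
  apply: eq_bigr => x _.
  have -> : \sum_y u x * lap x y * u y
      = (degree x)%:R * u x * (\sum_y (x == y)%:R * u y)
        - \sum_y (adj x y)%:R * (u x * u y).
    rewrite mulr_sumr -sumrB; apply: eq_bigr => y _; rewrite /lap; ring.
  rewrite sum_delta natr_degree !mulr_suml -sumrB.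
  by apply: eq_bigr => y _; ring.
set S := LHS; suff <- : S + S = \sum_x \sum_y (adj x y)%:R * (u x - u y) ^+ 2.
  by field.
rewrite {2}/S exchange_big -big_split; apply: eq_bigr => x _.
rewrite -big_split; apply: eq_bigr => y _ /=.
by rewrite [adj y x]adj_sym; ring.
Qed.

Lemma lap_form_ge0 (u : G -> R) : 0 <= \sum_x \sum_y u x * lap x y * u y.
Proof.
rewrite lap_form mulr_ge0 ?invr_ge0 ?ler0n // sumr_ge0 // => x _.
by rewrite sumr_ge0 // => y _; rewrite mulr_ge0 ?ler0n ?sqr_ge0.
Qed.

Lemma lap_form_eq0 (u : G -> R) : connected G ->
  \sum_x \sum_y u x * lap x y * u y = 0 -> forall x y, u x = u y.
Proof.
move=> conn /eqP; rewrite lap_form mulf_eq0 invr_eq0 pnatr_eq0 /=.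
have ge0 x y : 0 <= (adj x y)%:R * (u x - u y) ^+ 2.
  by rewrite mulr_ge0 ?ler0n ?sqr_ge0.
rewrite psumr_eq0 => [/allP u0|x _]; last exact: sumr_ge0.
have u_adj x y : adj x y -> u x = u y.
  move=> xy; have := u0 x (mem_index_enum x); rewrite psumr_eq0 // => /allP.
  move=> /(_ y (mem_index_enum y)) /=.
  by rewrite xy mul1r sqrf_eq0 subr_eq0 => /eqP.
move=> x y; have /connectP[p xp ->] := conn x y.
by elim: p x xp => //= z p IHp x /andP[/u_adj-> /IHp].
Qed.

End LaplacianKernel.

Section LaplacianMatrix.
Variables (R : rcfType) (G : sgraph).
Let n := #|G|.
Let L : 'M[R]_n := laplacian R G.

Lemma laplacianE i j : L i j = lap R (enum_val i) (enum_val j).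
Proof.
by rewrite !mxE /lap (inj_eq enum_val_inj) mulr_natr.
Qed.

Lemma sum_enum_rank (F : 'I_n -> R) : \sum_(x : G) F (enum_rank x) = \sum_i F i.
Proof.
rewrite (reindex (@enum_val G predT)) /=; last exact/onW_bij/enum_val_bij.
by apply: eq_bigr => i _; rewrite enum_valK.
Qed.

Lemma laplacian_form (v : 'rV[R]_n) :
  (v *m L *m v^T) 0 0
    = \sum_x \sum_y v 0 (enum_rank x) * lap R x y * v 0 (enum_rank y).
Proof.
rewrite mxE exchange_big -sum_enum_rank; apply: eq_bigr => y _.
rewrite !mxE -sum_enum_rank mulr_suml; apply: eq_bigr => x _.
by rewrite laplacianE !enum_rankK.
Qed.

Lemma row_norm_eq0 (v : 'rV[R]_n) : (v *m v^T) 0 0 <= 0 -> v = 0.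
Proof.
rewrite mxE => v_le0; have v0 : \sum_i v 0 i * v^T i 0 == 0.
  by rewrite eq_le v_le0 sumr_ge0 // => i _; rewrite mxE -expr2 sqr_ge0.
apply/rowP=> i; rewrite mxE; move: v0; rewrite psumr_eq0 => [/allP|j _].
  move=> /(_ i (mem_index_enum i)) /=.
  by rewrite mxE mulf_eq0 orbb => /eqP.
by rewrite mxE -expr2 sqr_ge0.
Qed.

(** A Laplacian is positive semidefinite, so any positive shift makes it
definite. *)
Lemma unitmx_shift_laplacian (a b : R) :
  0 < a -> 0 <= b -> a%:M + b *: L \in unitmx.
Proof.
move=> a_gt0 b_ge0; rewrite -row_free_unit; apply: inj_row_free => v v0.
have : a * (v *m v^T) 0 0 + b * (v *m L *m v^T) 0 0 = 0.
  transitivity ((v *m (a%:M + b *: L) *m v^T) 0 0); last first.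
    by rewrite v0 mul0mx mxE.
  rewrite [in RHS]mulmxDr [in RHS]mulmxDl mul_mx_scalar -scalemxAr.
  rewrite -!scalemxAl [RHS]mxE.
  by congr (_ + _); rewrite [RHS]mxE.
have Q_ge0 : 0 <= (v *m L *m v^T) 0 0 by rewrite laplacian_form lap_form_ge0.
move=> avv; apply: row_norm_eq0; rewrite -(pmulr_rle0 _ a_gt0).
by have := mulr_ge0 b_ge0 Q_ge0; lra.
Qed.

(** J / n, the orthogonal projection onto the constants. *)
Definition mean_mx : 'M[R]_n := const_mx 1 *m (const_mx n%:R^-1 : 'rV_n).

Lemma laplacian_mul_ones : L *m (const_mx 1 : 'cV_n) = 0.
Proof.
apply/colP=> i; rewrite !mxE -[RHS](sum_lap R (enum_val i)) -[LHS]sum_enum_rank.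
by apply: eq_bigr => x _; rewrite laplacianE enum_rankK mxE mulr1.
Qed.

Lemma mul_mean_row (v : 'rV[R]_n) :
  v *m mean_mx = (\sum_i v 0 i) *: (const_mx n%:R^-1 : 'rV_n).
Proof.
apply/rowP=> j; rewrite mulmxA !mxE big_ord1 !mxE; congr (_ * _).
by apply: eq_bigr => i _; rewrite mxE mulr1.
Qed.

(** On a connected graph the Dirichlet form of L vanishes on constants only, and
there the projection onto the constants is definite. *)
Lemma unitmx_laplacian_mean : connected G -> L + mean_mx \in unitmx.
Proof.
move=> conn; rewrite -row_free_unit; apply: inj_row_free => v v0.
have n_gt0 (i : 'I_n) : n%:R != 0 :> R.
  by rewrite pnatr_eq0 -lt0n (leq_ltn_trans _ (ltn_ord i)).
move: (v0) => /(congr1 (fun w => (w *m v^T) 0 0)).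
rewrite mulmxDr mulmxDl mul0mx [LHS]mxE [RHS]mxE laplacian_form mul_mean_row.
set s := \sum_i v 0 i.
have -> : (s *: (const_mx n%:R^-1 : 'rV_n) *m v^T) 0 0 = n%:R^-1 * s ^+ 2.
  rewrite -scalemxAl !mxE [in RHS]expr2 mulrCA; congr (_ * _).
  by rewrite mulr_sumr; apply: eq_bigr => i _; rewrite !mxE.
have Q_ge0 := lap_form_ge0 (fun x => v 0 (enum_rank x)).
have s_ge0 : 0 <= n%:R^-1 * s ^+ 2.
  by rewrite mulr_ge0 ?invr_ge0 ?ler0n ?sqr_ge0.
move=> /eqP; rewrite paddr_eq0 // => /andP[/eqP Q0 /eqP s0].
have v_const := lap_form_eq0 conn Q0.
apply/rowP=> i; rewrite mxE; move/eqP: s0.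
rewrite mulf_eq0 invr_eq0 (negPf (n_gt0 i)) sqrf_eq0 /=.
have -> : s = n%:R * v 0 i.
  rewrite /s -sum_enum_rank (eq_bigr (fun=> v 0 i)) => [|x _].
    by rewrite sumr_const mulr_natl.
  by rewrite (v_const x (enum_val i)) enum_valK.
by rewrite mulf_eq0 (negPf (n_gt0 i)) => /eqP.
Qed.

Section Regular.
Variables (r : nat) (reg : regular G r).

(** When r = 0 both sides vanish, with 0^-1 = 0. *)
Lemma normalized_laplacian_regular : normalized_laplacian R G = r%:R^-1 *: L.
Proof.
apply/matrixP=> i j.
rewrite /normalized_laplacian /degree_isqrt_mx mul_mx_diag mul_diag_mx.
rewrite !mxE !reg.
have rr : (Num.sqrt r%:R)^-1 * (Num.sqrt r%:R)^-1 = r%:R^-1 :> R.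
  by rewrite -invfM -expr2 sqr_sqrtr ?ler0n.
rewrite mulrAC rr mulrBr; congr (_ - _).
case: eqP => [_|_]; last by rewrite mulr0n mulr0.
case: (posnP r) => [->|r_gt0]; first by rewrite mulr0.
by rewrite mulr1n mulVf // pnatr_eq0 -lt0n.
Qed.

Lemma laplacian_regular : L = r%:R *: normalized_laplacian R G.
Proof.
rewrite normalized_laplacian_regular scalerA.
have [r0|r_gt0] := posnP r; last by rewrite mulfV ?scale1r // pnatr_eq0 -lt0n.
rewrite r0 mul0r scale0r; apply/matrixP=> i j.
rewrite laplacianE mxE /lap reg r0 mul0r sub0r.
have := reg (enum_val i); rewrite r0 => /eqP; rewrite cards_eq0 => /eqP/setP.
by move=> /(_ (enum_val j)); rewrite !inE => ->; rewrite oppr0.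
Qed.

Variable s : seq R.
Hypothesis spec : spectrum_of (normalized_laplacian R G) s.
Hypothesis n_gt0 : (0 < n)%N.

Lemma spectrum_ge0 x : x \in s -> 0 <= x.
Proof.
move=> xs; rewrite leNgt; apply/negP=> x_lt0.
have := unitmx_shift_laplacian (a := - x) (b := r%:R^-1).
rewrite oppr_gt0 invr_ge0 ler0n.
move=> /(_ x_lt0 isT); rewrite -normalized_laplacian_regular.
rewrite -[normalized_laplacian _ _]scale1r.
rewrite (splits_unitmx (splits_affine spec.2 _ _)) => /negP; apply.
by apply/mapP; exists x => //; rewrite mul1r addNr.
Qed.

(** 0 is an eigenvalue because constants are in the kernel, and it comes last
because the eigenvalues are nonnegative and sorted. *)
Lemma spectrum_rcons : exists s', [/\ s = rcons s' 0, size s' = n.-1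
  & forall f : R -> R, \sum_(j < n.-1) f s`_j = \sum_(x <- s') f x].
Proof.
have s0 : 0 \in s.
  apply/negPn; rewrite -(splits_unitmx spec.2); apply/negP => Lu.
  have : normalized_laplacian R G *m (const_mx 1 : 'cV_n) = 0.
    by rewrite normalized_laplacian_regular -scalemxAl laplacian_mul_ones
      scaler0.
  move=> /(congr1 (mulmx (invmx (normalized_laplacian R G)))).
  rewrite mulKmx // mulmx0 => /colP /(_ (Ordinal n_gt0)); rewrite !mxE => /eqP.
  by rewrite oner_eq0.
have := splits_size spec.2; have [sorted_s _] := spec.
have := spectrum_ge0.
case/lastP: s s0 sorted_s => [//|s' y] s0 sorted_s ge0.
rewrite size_rcons => sz.
have sz' : size s' = n.-1 := congr1 predn sz.
have y0 : y = 0.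
  apply/eqP; rewrite eq_le ge0 ?mem_rcons ?mem_head // andbT.
  move: s0; rewrite mem_rcons inE => /orP[/eqP-> //|s'0].
  move: sorted_s; rewrite (sorted_pairwise ge_trans) pairwise_rcons.
  by case/andP=> /allP /(_ 0 s'0).
exists s'; split=> // [|f]; first by rewrite y0.
rewrite (big_nth 0) -sz' big_mkord; apply: eq_bigr => i _.
by rewrite nth_rcons ltn_ord.
Qed.

End Regular.
End LaplacianMatrix.

(** * Green kernels *)

Section GreenKernels.
Variables (R : rcfType) (G : sgraph) (r : nat) (s : seq R).
Hypothesis reg : regular G r.
Hypothesis spec : spectrum_of (normalized_laplacian R G) s.
Hypothesis G_gt0 : (0 < #|G|)%N.

Lemma mulmx_kernel (M N P : 'M[R]_#|G|) (x y : G) : M *m N = P ->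
  \sum_z M (enum_rank x) (enum_rank z) * N (enum_rank z) (enum_rank y)
    = P (enum_rank x) (enum_rank y).
Proof.
move=> <-; rewrite mxE.
exact: (sum_enum_rank (fun i => M (enum_rank x) i * N i (enum_rank y))).
Qed.

Lemma trace_kernel (M : 'M[R]_#|G|) :
  \sum_x M (enum_rank x) (enum_rank x) = \tr M.
Proof. exact: (sum_enum_rank (fun i => M i i)). Qed.

(** The resolvent of the Laplacian at - c.  It has constant row sums because
constants are eigenvectors; the last summand of the trace is theirs. *)
Lemma green_kernel (c : R) : 0 < c -> exists X : G -> G -> R,
  [/\ forall x y, \sum_z X x z * (c * (z == y)%:R + lap R z y) = (x == y)%:R,
      forall x, \sum_y X x y = c^-1
    & \sum_x X x x = \sum_(j < #|G|.-1) (c + r%:R * s`_j)^-1 + c^-1].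
Proof.
move=> c_gt0; pose M := c%:M + 1 *: laplacian R G.
have Mu : M \in unitmx by apply: unitmx_shift_laplacian.
have ME x y : M (enum_rank x) (enum_rank y) = c * (x == y)%:R + lap R x y.
  rewrite mxE scale1r laplacianE !enum_rankK mxE (inj_eq enum_rank_inj).
  by rewrite mulr_natr.
pose X x y := invmx M (enum_rank x) (enum_rank y).
have XM x y : \sum_z X x z * (c * (z == y)%:R + lap R z y) = (x == y)%:R.
  under eq_bigr do rewrite -ME.
  by rewrite (mulmx_kernel _ _ (mulVmx Mu)) mxE (inj_eq enum_rank_inj).
exists X; split=> // [x|].
  have : \sum_y \sum_z X x z * (c * (z == y)%:R + lap R z y) = 1.
    by under eq_bigr do rewrite XM; rewrite sum_delta1.
  rewrite exchange_big (eq_bigr (fun z => X x z * c)) => [|z _].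
    by rewrite -mulr_suml => Xc; rewrite -[RHS]mul1r -Xc mulfK // lt0r_neq0.
  rewrite -mulr_sumr big_split /= sum_lap addr0 -mulr_sumr.
  by rewrite sum_delta1 mulr1.
rewrite trace_kernel (@trace_invmx _ _ _ [seq c + r%:R * x | x <- s]) //.
  have [s' [sE _ sumE]] := spectrum_rcons reg spec G_gt0.
  rewrite (sumE (fun x => (c + r%:R * x)^-1)) big_map sE big_rcons /=.
  by rewrite mulr0 addr0 addrC.
by rewrite /M scale1r (laplacian_regular R reg); exact: (splits_affine spec.2).
Qed.

(** Z = (L + J / n)^-1 - J / n: adding J / n to L turns the eigenvalue 0 of the
constants into 1, and subtracting it from the inverse turns that 1 back into 0.
Invertibility of L + J / n is also what shows that the first n - 1 eigenvalues
do not vanish. *)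
Lemma pseudo_inverse_kernel : connected G -> (0 < r)%N ->
  exists Z : G -> G -> R,
  [/\ forall x y, \sum_z Z x z * lap R z y = (x == y)%:R - #|G|%:R^-1,
      forall x, \sum_y Z x y = 0,
      forall i, (i < #|G|.-1)%N -> s`_i != 0
    & \sum_x Z x x = \sum_(i < #|G|.-1) (r%:R * s`_i)^-1].
Proof.
move=> conn r_gt0; set L := laplacian R G.
have n0 : #|G|%:R != 0 :> R by rewrite pnatr_eq0 -lt0n.
pose J : 'M[R]_#|G| := mean_mx R G; pose M := L + J.
have Mu : M \in unitmx by apply: unitmx_laplacian_mean.
have JE i j : J i j = #|G|%:R^-1 by rewrite mxE big_ord1 !mxE mul1r.
have L1 : L *m (const_mx 1 : 'cV_#|G|) = 0 by apply: laplacian_mul_ones.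
have r1 : (const_mx #|G|%:R^-1 : 'rV[R]_#|G|) *m (const_mx 1 : 'cV_#|G|) = 1%:M.
  apply/matrixP=> i j; rewrite !mxE !ord1.
  rewrite (eq_bigr (fun=> #|G|%:R^-1)) => [|k _].
    by rewrite sumr_const card_ord -[LHS]mulr_natr mulVf.
  by rewrite !mxE mulr1.
have M1 : M *m (const_mx 1 : 'cV_#|G|) = const_mx 1.
  by rewrite mulmxDl L1 add0r -mulmxA r1 mulmx1.
have NJ : invmx M *m J = J.
  have MJ : M *m J = J by rewrite mulmxA M1.
  by rewrite -{1}MJ mulKmx.
have JL : J *m L = 0.
  apply/matrixP=> i j; rewrite !mxE -sum_enum_rank.
  rewrite (eq_bigr (fun x => #|G|%:R^-1 * lap R (enum_val j) x)) => [|x _].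
    by rewrite -mulr_sumr sum_lap mulr0.
  by rewrite JE laplacianE enum_rankK lapC.
have NL : invmx M *m L = 1%:M - J.
  by rewrite -(addrK J L) mulmxBr mulVmx // NJ.
have [s' [sE size_s' sumE]] := spectrum_rcons reg spec G_gt0.
have Ls : splits L (0 :: [seq r%:R * x | x <- s']).
  rewrite /L (laplacian_regular R reg) -[_ *: _]add0r.
  rewrite -(raddf0 (@scalar_mx R _)).
  rewrite /splits (splits_affine spec.2) sE map_rcons big_rcons big_cons.
  rewrite mulr0 addr0 [LHS]mulrC; congr (_ * _); rewrite !big_map.
  by under eq_bigr do rewrite add0r.
pose Z x y := (invmx M - J) (enum_rank x) (enum_rank y).
exists Z; split=> [x y|x|i i_lt|].
- have -> : \sum_z Z x z * lap R z y
      = \sum_z Z x z * L (enum_rank z) (enum_rank y).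
    by apply: eq_bigr => z _; rewrite laplacianE !enum_rankK.
  rewrite (@mulmx_kernel _ _ (1%:M - J)); last by rewrite mulmxBl NL JL subr0.
  by rewrite mxE [(- J) _ _]mxE JE mxE (inj_eq enum_rank_inj).
- transitivity (((invmx M - J) *m (const_mx 1 : 'cV_#|G|)) (enum_rank x) 0).
    rewrite mxE -sum_enum_rank; apply: eq_bigr => y _.
    by rewrite [const_mx _ _ _]mxE mulr1.
  by rewrite mulmxBl -{1}M1 mulKmx // -mulmxA r1 mulmx1 subrr mxE.
- have : 0 \notin 1 :: [seq r%:R * x | x <- s'].
    by rewrite -(splits_unitmx (splits_deflate Ls L1 r1)).
  apply: contraNneq => si0; rewrite inE; apply/orP; right; apply/mapP.
  have i_s' : (i < size s')%N by rewrite size_s'.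
  exists s'`_i; first exact: mem_nth.
  have <- : s`_i = s'`_i by rewrite sE nth_rcons i_s'.
  by rewrite si0 mulr0.
rewrite trace_kernel raddfB /=.
rewrite (trace_invmx (splits_deflate Ls L1 r1)) // big_cons invr1 big_map.
rewrite (sumE (fun x => (r%:R * x)^-1)).
have -> : \tr J = 1.
  rewrite /mxtrace (eq_bigr (fun=> #|G|%:R^-1)) => [|i _]; last exact: JE.
  by rewrite sumr_const card_ord -[LHS]mulr_natr mulVf.
by rewrite addrAC subrr add0r.
Qed.

End GreenKernels.

(** * The degree-Kirchhoff index from a generalised inverse *)

Section DegreeKirchhoff.
Variables (R : rcfType) (G : sgraph).
Variables (X : G -> G -> R) (w : G -> R).
Hypothesis XL : forall x y, \sum_z X x z * lap R z y = (x == y)%:R - w y.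

(** Write d for the row with 1 at i and -1 at j.  The hypothesis gives
d X L = d, so that d is in the row space of L and the chosen potential v does
satisfy v L = d.  As L is symmetric, d^T = L X^T d^T, hence
v d^T = v L X^T d^T = d X^T d^T, whichever solution v was chosen. *)
Lemma effective_resistanceE (i j : 'I_#|G|)
    (x := enum_val i) (y := enum_val j) :
  effective_resistance R i j = X x x + X y y - X x y - X y x.
Proof.
set L := laplacian R G.
pose M : 'M[R]_#|G| := \matrix_(a, b) X (enum_val a) (enum_val b).
pose W : 'rV[R]_#|G| := \row_a w (enum_val a).
pose d : 'rV[R]_#|G| := delta_mx 0 i - delta_mx 0 j.
have ML : M *m L = 1%:M - const_mx 1 *m W.
  apply/matrixP=> a b; rewrite !mxE -sum_enum_rank big_ord1 !mxE mul1r.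
  rewrite -(inj_eq enum_val_inj) -XL; apply: eq_bigr => z _.
  by rewrite laplacianE !mxE enum_rankK.
have dML : d *m M *m L = d.
  rewrite -mulmxA ML mulmxBr mulmx1 mulmxA mulmxBl -!rowE.
  have -> : row i (const_mx 1 : 'cV[R]_#|G|) = row j (const_mx 1).
    by apply/rowP=> k; rewrite !mxE.
  by rewrite subrr mul0mx subr0.
have LT : L^T = L by apply/matrixP=> a b; rewrite mxE !laplacianE lapC.
have vL : d *m pinvmx L *m L = d by apply: mulmxKpV; rewrite -dML submxMl.
have at_d (v : 'rV[R]_#|G|) : v 0 i - v 0 j = (v *m d^T) 0 0.
  by rewrite /d linearB /= mulmxBr !trmx_delta -!colE !mxE.
rewrite /effective_resistance /unit_current_potential -/L -/d at_d.
have -> : d^T = L *m (M^T *m d^T) by rewrite -{1}dML trmx_mul LT trmx_mul.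
rewrite mulmxA vL mulmxA -at_d /d mulmxBl -!rowE !mxE -/x -/y.
ring.
Qed.

Lemma sum_ltn_sym (n : nat) (F : 'I_n -> 'I_n -> R) :
    (forall i j, F i j = F j i) -> (forall i, F i i = 0) ->
  \sum_i \sum_j F i j = 2 * \sum_(i < n) \sum_(j < n | (i < j)%N) F i j.
Proof.
move=> FC F0; set S := \sum_(i < n) _.
have -> : 2 * S = S + \sum_(i < n) \sum_(j < n | (j < i)%N) F i j.
  rewrite mulr2n mulrDl mul1r; congr (_ + _).
  rewrite /S (exchange_big_dep xpredT) //=; apply: eq_bigr => i _.
  by apply: eq_bigr => j _.
rewrite -big_split; apply: eq_bigr => i _ /=.
rewrite (bigID (fun j : 'I_n => (i < j)%N)) /=; congr (_ + _).
rewrite (bigD1 i) ?ltnn //= F0 add0r; apply: eq_bigl => j.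
by rewrite -leqNgt ltn_neqAle andbC.
Qed.

Lemma degree_kirchhoff_ginv (d := fun x : G => (degree x)%:R : R) :
  degree_kirchhoff R G =
    (\sum_x d x) * (\sum_x d x * X x x) - \sum_x \sum_y d x * X x y * d y.
Proof.
pose F (i j : 'I_#|G|) :=
  d (enum_val i) * d (enum_val j) * effective_resistance R i j.
have twice : \sum_i \sum_j F i j = 2 * degree_kirchhoff R G.
  by rewrite sum_ltn_sym // => [i j|i]; rewrite /F !effective_resistanceE; ring.
apply: (@mulfI _ 2); rewrite ?pnatr_eq0 // -twice.
transitivity (\sum_x \sum_y d x * d y * (X x x + X y y - X x y - X y x)).
  rewrite -sum_enum_rank; apply: eq_bigr => x _.
  rewrite -sum_enum_rank; apply: eq_bigr => y _.
  by rewrite /F effective_resistanceE !enum_rankK.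
have E1 : \sum_x \sum_y d x * d y * X x x = (\sum_x d x) * (\sum_x d x * X x x).
  rewrite mulrC mulr_suml; apply: eq_bigr => x _.
  by rewrite mulr_sumr; apply: eq_bigr => y _; ring.
have E2 : \sum_x \sum_y d x * d y * X y y = (\sum_x d x) * (\sum_x d x * X x x).
  rewrite -E1 exchange_big; apply: eq_bigr => x _; apply: eq_bigr => y _; ring.
have E3 : \sum_x \sum_y d x * d y * X y x = \sum_x \sum_y d x * X x y * d y.
  rewrite exchange_big; apply: eq_bigr => x _; apply: eq_bigr => y _; ring.
transitivity (\sum_x (\sum_y d x * d y * X x x + \sum_y d x * d y * X y y
   - (\sum_y d x * d y * X y x + \sum_y d x * X x y * d y))).
  apply: eq_bigr => x _; rewrite -!big_split -sumrB /=.
  by apply: eq_bigr => y _; ring.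
by rewrite sumrB !big_split /= E1 E2 E3; ring.
Qed.

End DegreeKirchhoff.

Section Reindexed.
Variables (R : rcfType) (G : sgraph) (A : finType) (phi : A -> G).
Hypothesis phi_bij : bijective phi.
Variables (X : A -> A -> R) (w : A -> R).
Hypothesis XL :
  forall a b, \sum_c X a c * lap R (phi c) (phi b) = (a == b)%:R - w b.

Lemma degree_kirchhoff_reindex (d := fun a => (degree (phi a))%:R : R) :
  degree_kirchhoff R G =
    (\sum_a d a) * (\sum_a d a * X a a) - \sum_a \sum_b d a * X a b * d b.
Proof.
have [psi phiK psiK] := phi_bij.
have re (F : G -> R) : \sum_x F x = \sum_a F (phi a).
  by rewrite (reindex phi) //; apply: onW_bij.
rewrite (@degree_kirchhoff_ginv _ _ (fun x y => X (psi x) (psi y)) (w \o psi)).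
  rewrite !re; congr (_ * _ - _); first by apply: eq_bigr => a _; rewrite phiK.
  apply: eq_bigr => a _; rewrite re; apply: eq_bigr => b _.
  by rewrite !phiK.
move=> x y; rewrite re /= -(inj_eq (can_inj psiK)) -XL.
by apply: eq_bigr => c _; rewrite phiK psiK.
Qed.

End Reindexed.

(** * Eliminating vertices *)

(** In matrix notation: g L = 1 - h iota, h^T L = S iota and Y S = 1 - 1 w give
(g + h Y h^T) L = 1 - h iota + h (1 - 1 w) iota = 1 - 1 w iota.  Here iota
embeds the retained vertices C into A, g is the Green kernel of the eliminated
ones, the rows of h are the harmonic measures on C, which have mass 1, and S
is the Schur complement. *)
Lemma schur_ginv (R : pzRingType) (A C : finType) (L g : A -> A -> R)
    (h : A -> C -> R) (iota : C -> A -> R) (S Y : C -> C -> R) (w : C -> R) :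
    (forall a b,
       \sum_c g a c * L c b = (a == b)%:R - \sum_e h a e * iota e b) ->
    (forall f b, \sum_c h c f * L c b = \sum_e S f e * iota e b) ->
    (forall e f, \sum_k Y e k * S k f = (e == f)%:R - w f) ->
    (forall a, \sum_e h a e = 1) ->
  forall a b, \sum_c (g a c + \sum_e \sum_f h a e * Y e f * h c f) * L c b
    = (a == b)%:R - \sum_e w e * iota e b.
Proof.
move=> gL hL YS h1 a b.
under eq_bigr do rewrite mulrDl; rewrite big_split /= gL.
have -> : \sum_c (\sum_e \sum_f h a e * Y e f * h c f) * L c b
    = \sum_e h a e * iota e b - \sum_e w e * iota e b.
  transitivity (\sum_e \sum_f h a e * Y e f * \sum_c h c f * L c b).
    under eq_bigr do rewrite mulr_suml.
    rewrite exchange_big; apply: eq_bigr => e _ /=.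
    under eq_bigr do rewrite mulr_suml.
    rewrite exchange_big; apply: eq_bigr => f _ /=.
    by rewrite mulr_sumr; apply: eq_bigr => c _; rewrite mulrA.
  transitivity (\sum_e h a e * \sum_k (\sum_f Y e f * S f k) * iota k b).
    apply: eq_bigr => e _; under [in RHS]eq_bigr do rewrite mulr_suml.
    rewrite exchange_big mulr_sumr; apply: eq_bigr => f _ /=.
    rewrite hL -mulrA mulr_sumr; congr (_ * _).
    by apply: eq_bigr => k _; rewrite mulrA.
  transitivity (\sum_e (h a e * iota e b - h a e * \sum_k w k * iota k b)).
    apply: eq_bigr => e _; rewrite -mulrBr; congr (_ * _).
    under eq_bigr do rewrite YS mulrBl.
    by rewrite sumrB sum_delta.
  by rewrite sumrB -mulr_suml h1 mul1r.
by rewrite addrA subrK.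
Qed.

(** * Coronas over a biregular bipartite graph *)

(** The matrix N = B B^T of an incidence relation, with B its 0-1 matrix. *)
Definition common (R : rcfType) (C T : finType) (inc : C -> T -> bool)
    (c c' : C) : R :=
  \sum_t (inc c t)%:R * (inc c' t)%:R.

(** The first factor is the sum of all degrees.  The second one is the trace of
D X; its last summand collects the terms in Y, where
tr (Y N) = k (l tr Y - (#|C| - 1)).  The subtracted part is d g d^T. *)
Definition bicorona_kirchhoff (R : rcfType) (nC nT nH nK k l rH rK : nat)
    (tH tK tY : R) : R :=
  let dC : R := (l + l * nH + nK)%:R in
  (nC%:R * dC + (nT * k + nT * nH * (k + rH) + nC * nK * (1 + rK))%:R)
  * (nT%:R + (nT * (k + rH))%:R * tH + (nC * (1 + rK))%:R * tK
     + ((dC + (nK * (1 + rK))%:R) * tY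
        + (1 + (nH * (k + rH))%:R / k%:R) * (l%:R * tY - (nC%:R - 1)))
       / (1 + nH)%:R)
  - ((nT * k)%:R + (nT * nH)%:R * (k + rH)%:R ^+ 2 / k%:R
     + (nC * nK * (1 + rK) ^ 2)%:R).

Section Bicorona.
Variables (R : rcfType) (C T : finType) (inc : C -> T -> bool) (H K : sgraph).

Definition bicorona_vertex : finType := ((C + T) + (T * H + C * K))%type.

Definition bicorona_adj (a b : bicorona_vertex) : bool :=
  match a, b with
  | inl (inl c), inl (inr t) | inl (inr t), inl (inl c) => inc c t
  | inl (inl c), inr (inl (t, _)) | inr (inl (t, _)), inl (inl c) => inc c t
  | inl (inl c), inr (inr (c', _)) | inr (inr (c', _)), inl (inl c) => c == c'
  | inr (inl (t, x)), inr (inl (t', y)) => (t == t') && adj x y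
  | inr (inr (c, x)), inr (inr (c', y)) => (c == c') && adj x y
  | _, _ => false
  end.

Variables (G : sgraph) (phi : bicorona_vertex -> G).
Hypothesis phi_bij : bijective phi.
Hypothesis phi_adj : forall a b, adj (phi a) (phi b) = bicorona_adj a b.

Variables (k l rH rK : nat).
Hypothesis k_gt0 : (0 < k)%N.
Hypothesis inc_k : forall t, #|[set c | inc c t]| = k.
Hypothesis inc_l : forall c, #|[set t | inc c t]| = l.
Hypothesis regH : regular H rH.
Hypothesis regK : regular K rK.

Local Notation nH := (#|H|%:R : R).
Local Notation nK := (#|K|%:R : R).
Let B c t : R := (inc c t)%:R.

Let sumBC t : \sum_c B c t = k%:R.
Proof.
by rewrite -(inc_k t) -sum_pred.
Qed.

Let sumBT c : \sum_t B c t = l%:R.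
Proof.
by rewrite -(inc_l c) -sum_pred.
Qed.

Let big_bicorona (F : bicorona_vertex -> R) :
  \sum_a F a = \sum_c F (inl (inl c)) + \sum_t F (inl (inr t))
    + (\sum_t \sum_x F (inr (inl (t, x))) + \sum_c \sum_x F (inr (inr (c, x)))).
Proof.
rewrite !big_sumType /= !pair_bigA /=; congr (_ + _ + (_ + _)).
  by apply: eq_bigr => -[].
by apply: eq_bigr => -[].
Qed.

Let degC : R := l%:R + l%:R * nH + nK.

Let deg a : R :=
  match a : bicorona_vertex with
  | inl (inl _) => degC
  | inl (inr _) => k%:R
  | inr (inl _) => k%:R + rH%:R
  | inr (inr _) => 1 + rK%:R
  end.

Lemma natr_degree_bicorona a : (degree (phi a))%:R = deg a.
Proof.
rewrite natr_degree (reindex phi) /=; last exact: onW_bij.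
under eq_bigr do rewrite phi_adj.
rewrite big_bicorona.
case: a => [[c|t]|[[t x]|[c x]]] /=.
all: rewrite ?sumBC ?sumBT ?sum_cst ?mulr0 ?add0r ?addr0.
- under eq_bigr do rewrite sum_cst.
  rewrite -mulr_sumr sumBT exchange_big /=.
  by under eq_bigr do rewrite sum_delta1; rewrite sum_cst /degC; ring.
- done.
- under eq_bigr do under eq_bigr do rewrite -mulnb natrM.
  under eq_bigr do rewrite -mulr_sumr.
  by rewrite sum_delta -natr_degree regH.
- under eq_bigr do rewrite eq_sym.
  rewrite sum_delta1; under eq_bigr do under eq_bigr do rewrite -mulnb natrM.
  under eq_bigr do rewrite -mulr_sumr.
  by rewrite sum_delta -natr_degree regK.
Qed.

Let lapB (a b : bicorona_vertex) : R :=
  match a, b with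
  | inl (inl c), inl (inl c') => degC * (c == c')%:R
  | inl (inr t), inl (inr t') => k%:R * (t == t')%:R
  | inl (inl c), inl (inr t) | inl (inr t), inl (inl c) => - B c t
  | inl (inl c), inr (inl (t, _)) | inr (inl (t, _)), inl (inl c) => - B c t
  | inl (inl c), inr (inr (c', _)) | inr (inr (c', _)), inl (inl c) =>
      - (c == c')%:R
  | inr (inl (t, x)), inr (inl (t', y)) =>
      (t == t')%:R * (k%:R * (x == y)%:R + lap R x y)
  | inr (inr (c, x)), inr (inr (c', y)) =>
      (c == c')%:R * (1 * (x == y)%:R + lap R x y)
  | _, _ => 0
  end.

Let lapE a b : lap R (phi a) (phi b) = lapB a b.
Proof.
rewrite /lap natr_degree_bicorona phi_adj (inj_eq (bij_inj phi_bij)).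
case: a b => [[c|t]|[[t x]|[c x]]] [[c'|t']|[[t' y]|[c' y]]] /=.
all: rewrite ?mulr0 ?sub0r ?subr0 ?oppr0 ?[c' == c]eq_sym //.
  rewrite -[inr _ == inr _]/((t == t') && (x == y)) -!mulnb !natrM /lap regH.
  by ring.
rewrite -[inr _ == inr _]/((c == c') && (x == y)) -!mulnb !natrM /lap regK.
by ring.
Qed.

(* The resolvents of H and K, and a pseudo-inverse of l - N / k. *)
Variables (GH : H -> H -> R) (GK : K -> K -> R) (Y : C -> C -> R).
Hypothesis GH_inv :
  forall x y, \sum_z GH x z * (k%:R * (z == y)%:R + lap R z y) = (x == y)%:R.
Hypothesis GH_row : forall x, \sum_y GH x y = k%:R^-1.
Hypothesis GK_inv :
  forall x y, \sum_z GK x z * (1 * (z == y)%:R + lap R z y) = (x == y)%:R.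
Hypothesis GK_row : forall x, \sum_y GK x y = 1^-1.

Let N : C -> C -> R := common R inc.
Hypothesis Y_inv : forall c c',
  \sum_e Y c e * (l%:R * (e == c')%:R - common R inc e c' / k%:R)
    = (c == c')%:R - #|C|%:R^-1.
Hypothesis Y_row : forall c, \sum_e Y c e = 0.
Hypothesis C_gt0 : (0 < #|C|)%N.

(* The inverse of the Laplacian restricted to the complement of C. *)
Let green (a b : bicorona_vertex) : R :=
  match a, b with
  | inl (inr t), inl (inr t') => (t == t')%:R * k%:R^-1
  | inr (inl (t, x)), inr (inl (t', y)) => (t == t')%:R * GH x y
  | inr (inr (c, x)), inr (inr (c', y)) => (c == c')%:R * GK x y
  | _, _ => 0
  end.

(* The probability that a random walk started at a first meets C at c. *)
Let harm (a : bicorona_vertex) (c : C) : R :=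
  match a with
  | inl (inl c') | inr (inr (c', _)) => (c == c')%:R
  | inl (inr t) | inr (inl (t, _)) => B c t / k%:R
  end.

Let core (c : C) (a : bicorona_vertex) : R :=
  if a is inl (inl c') then (c == c')%:R else 0.

Let sum0l (I : finType) (F : I -> R) : \sum_x 0 * F x = 0.
Proof. by rewrite -mulr_sumr mul0r. Qed.

Let sum00l (I J : finType) (F : I -> J -> R) : \sum_x \sum_y 0 * F x y = 0.
Proof. by apply: big1 => x _; apply: sum0l. Qed.

Let sum_green a (F : bicorona_vertex -> R) : \sum_b green a b * F b =
  match a with
  | inl (inl _) => 0
  | inl (inr t) => k%:R^-1 * F (inl (inr t))
  | inr (inl (t, x)) => \sum_y GH x y * F (inr (inl (t, y)))
  | inr (inr (c, x)) => \sum_y GK x y * F (inr (inr (c, y)))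
  end.
Proof.
rewrite big_bicorona; case: a => [[c|t]|[[t x]|[c x]]] /=.
all: rewrite ?sum0l ?sum00l ?add0r ?addr0 //.
- by under eq_bigr do rewrite -mulrA; rewrite sum_delta.
- under eq_bigr do under eq_bigr do rewrite -mulrA.
  by under eq_bigr do rewrite -mulr_sumr; rewrite sum_delta.
- under eq_bigr do under eq_bigr do rewrite -mulrA.
  by under eq_bigr do rewrite -mulr_sumr; rewrite sum_delta.
Qed.

Let sum_harm c (F : bicorona_vertex -> R) : \sum_a harm a c * F a =
  F (inl (inl c)) + (\sum_t B c t * F (inl (inr t))) / k%:R
  + ((\sum_t B c t * \sum_x F (inr (inl (t, x)))) / k%:R
     + \sum_x F (inr (inr (c, x)))).
Proof.
rewrite big_bicorona /= sum_delta; congr (_ + _ + (_ + _)).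
- by rewrite mulr_suml; apply: eq_bigr => t _; rewrite mulrAC.
- rewrite mulr_suml; apply: eq_bigr => t _.
  by rewrite -mulr_sumr mulrAC.
- by under eq_bigr do rewrite -mulr_sumr; rewrite sum_delta.
Qed.

Let sum_core (F : C -> R) b :
  \sum_e F e * core e b = if b is inl (inl c) then F c else 0.
Proof.
case: b => [[c|t]|p] /=; try by rewrite big1 // => e _; rewrite mulr0.
by under eq_bigr do rewrite eq_sym mulrC; rewrite sum_delta.
Qed.

Let green_lap a b :
  \sum_c green a c * lapB c b = (a == b)%:R - \sum_e harm a e * core e b.
Proof.
have k0 : k%:R != 0 :> R by rewrite pnatr_eq0 -lt0n.
rewrite sum_core sum_green.
case: a b => [[c|t]|[[t x]|[c x]]] [[c'|t']|[[t' y]|[c' y]]] /=.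
all: rewrite ?mulr0 ?subr0 //.
- by rewrite eq_sym subrr.
- by rewrite sub0r mulrN mulrC.
- by rewrite mulKf.
- by rewrite -mulr_suml GH_row mulrN sub0r mulrC.
- by rewrite big1 // => z _; rewrite mulr0.
- under eq_bigr do rewrite mulrCA.
  by rewrite -mulr_sumr GH_inv -natrM mulnb.
- by rewrite big1 // => z _; rewrite mulr0.
- by rewrite -mulr_suml GK_row invr1 mul1r sub0r.
- by rewrite big1 // => z _; rewrite mulr0.
- by rewrite big1 // => z _; rewrite mulr0.
- under eq_bigr do rewrite mulrCA.
  by rewrite -mulr_sumr GK_inv -natrM mulnb.
Qed.

Let sum_shift_lap (F : sgraph) (c : R) (y : F) :
  \sum_x (c * (x == y)%:R + lap R x y) = c.
Proof.
under eq_bigr do rewrite lapC eq_sym.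
by rewrite big_split /= sum_lap addr0 -mulr_sumr sum_delta1 mulr1.
Qed.

Let schur (c c' : C) : R := (1 + nH) * (l%:R * (c == c')%:R - N c c' / k%:R).

Let harm_lap c b :
  \sum_a harm a c * lapB a b = \sum_e schur c e * core e b.
Proof.
have k0 : k%:R != 0 :> R by rewrite pnatr_eq0 -lt0n.
rewrite sum_core sum_harm.
case: b => [[c'|t']|[[t' y]|[c' y]]] /=.
- rewrite /schur /N /common /degC !sum_cst.
  under eq_bigr do rewrite mulrN.
  under [X in _ + (X / _ + _)]eq_bigr do rewrite sum_cst mulrCA mulrN.
  rewrite -mulr_sumr !sumrN [c' == c]eq_sym; by field.
- under eq_bigr do rewrite mulrA mulrC eq_sym.
  rewrite sum_delta; under eq_bigr do rewrite big1_eq mulr0.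
  by rewrite !big1_eq; field.
- rewrite big1 => [|t _]; last by rewrite mulr0.
  under eq_bigr do rewrite -mulr_sumr sum_shift_lap mulrCA eq_sym.
  by rewrite sum_delta big1_eq; field.
- under eq_bigr do rewrite mulr0.
  under [X in _ + (X / _ + _)]eq_bigr do rewrite big1_eq mulr0.
  rewrite !big1_eq.
  by rewrite -mulr_sumr sum_shift_lap; ring.
Qed.

Let harm1 a : \sum_c harm a c = 1.
Proof.
have k0 : k%:R != 0 :> R by rewrite pnatr_eq0 -lt0n.
case: a => [[c|t]|[[t x]|[c x]]] /=.
all: try by under eq_bigr do rewrite eq_sym; rewrite sum_delta1.
all: by rewrite -mulr_suml sumBC divff.
Qed.

Let Y' c c' := Y c c' / (1 + nH).

Let nH1 : 1 + nH != 0.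
Proof. by rewrite lt0r_neq0 // ltr_wpDr ?ler0n ?ltr01. Qed.

Let Y'_inv c c' :
  \sum_e Y' c e * schur e c' = (c == c')%:R - #|C|%:R^-1.
Proof.
rewrite -Y_inv; apply: eq_bigr => e _.
by rewrite /Y' /schur mulrA divfK.
Qed.

Let NC c c' : N c c' = N c' c.
Proof. by apply: eq_bigr => t _; rewrite mulrC. Qed.

(* Taking traces in Y (l - N / k) = 1 - J / #|C|. *)
Let trace_YN : \sum_c \sum_e Y c e * N c e
  = k%:R * (l%:R * \sum_c Y c c - (#|C|%:R - 1)).
Proof.
have k0 : k%:R != 0 :> R by rewrite pnatr_eq0 -lt0n.
have C0 : #|C|%:R != 0 :> R by rewrite pnatr_eq0 -lt0n.
have row c : \sum_e Y c e * N c e = k%:R * (l%:R * Y c c - (1 - #|C|%:R^-1)).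
  have := Y_inv c c; rewrite eqxx => <-.
  have -> : \sum_e Y c e * (l%:R * (e == c)%:R - N e c / k%:R)
      = \sum_e ((c == e)%:R * (l%:R * Y c e) - Y c e * N c e / k%:R).
    by apply: eq_bigr => e _; rewrite eq_sym [N e c]NC; ring.
  by rewrite sumrB sum_delta -mulr_suml; field.
under eq_bigr do rewrite row.
by rewrite -mulr_sumr sumrB -mulr_sumr sum_cst; field.
Qed.

Let sum_degree : \sum_a deg a = #|C|%:R * degC + #|T|%:R * k%:R
  + (#|T|%:R * nH * (k%:R + rH%:R) + #|C|%:R * nK * (1 + rK%:R)).
Proof.
rewrite big_bicorona /= !sum_cst.
by congr (_ + (_ + _)); rewrite mulrA.
Qed.

Let sum_deg_harm c : \sum_a harm a c * deg a
  = degC + l%:R + (l%:R * nH * (k%:R + rH%:R) / k%:R + nK * (1 + rK%:R)).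
Proof.
have k0 : k%:R != 0 :> R by rewrite pnatr_eq0 -lt0n.
rewrite sum_harm /= -mulr_suml sumBT mulfK //.
under eq_bigr do rewrite sum_cst.
by rewrite -mulr_suml sumBT sum_cst mulrA.
Qed.

Let sum_harm_deg_harm c c' : \sum_a harm a c * (deg a * harm a c')
  = (degC + nK * (1 + rK%:R)) * (c == c')%:R
    + (k%:R^-1 + nH * (k%:R + rH%:R) / k%:R ^+ 2) * N c c'.
Proof.
have k0 : k%:R != 0 :> R by rewrite pnatr_eq0 -lt0n.
rewrite sum_harm /= [c' == c]eq_sym sum_cst.
have -> : \sum_t B c t * (k%:R * (B c' t / k%:R)) = N c c'.
  by apply: eq_bigr => t _; rewrite [k%:R * _]mulrC divfK.
have -> : \sum_t B c t * (\sum_(x : H) (k%:R + rH%:R) * (B c' t / k%:R))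
    = nH * (k%:R + rH%:R) / k%:R * N c c'.
  by rewrite mulr_sumr; apply: eq_bigr => t _; rewrite sum_cst; ring.
by field.
Qed.

Let trace_deg_green : \sum_a deg a * green a a
  = #|T|%:R + #|T|%:R * (k%:R + rH%:R) * (\sum_x GH x x)
    + #|C|%:R * (1 + rK%:R) * (\sum_x GK x x).
Proof.
have k0 : k%:R != 0 :> R by rewrite pnatr_eq0 -lt0n.
rewrite big_bicorona /=; under eq_bigr do rewrite mulr0.
rewrite big1_eq add0r -!mulrA -!sum_cst !mulr_sumr addrA.
congr (_ + _ + _).
- rewrite -[RHS]mulr1 -sum_cst; apply: eq_bigr => t _.
  by rewrite eqxx mul1r mulfV.
- by apply: eq_bigr => t _; apply: eq_bigr => x _; rewrite eqxx mul1r.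
- by apply: eq_bigr => c _; apply: eq_bigr => x _; rewrite eqxx mul1r.
Qed.

Let form_deg_green : \sum_a deg a * \sum_b green a b * deg b
  = #|T|%:R * k%:R + #|T|%:R * nH * (k%:R + rH%:R) ^+ 2 / k%:R
     + #|C|%:R * nK * (1 + rK%:R) ^+ 2.
Proof.
have k0 : k%:R != 0 :> R by rewrite pnatr_eq0 -lt0n.
under eq_bigr do rewrite sum_green.
rewrite big_bicorona /=; under eq_bigr do rewrite mulr0.
rewrite big1_eq add0r mulVf // mulr1 sum_cst -addrA; congr (_ + (_ + _)).
  under eq_bigr do under eq_bigr do rewrite -mulr_suml GH_row.
  by rewrite !sum_cst; ring.
under eq_bigr do under eq_bigr do rewrite -mulr_suml GK_row invr1.
by rewrite !sum_cst; ring.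
Qed.

Lemma degree_kirchhoff_bicorona : degree_kirchhoff R G
  = bicorona_kirchhoff #|C| #|T| #|H| #|K| k l rH rK
      (\sum_x GH x x) (\sum_x GK x x) (\sum_c Y c c).
Proof.
have k0 : k%:R != 0 :> R by rewrite pnatr_eq0 -lt0n.
pose X a b := green a b + \sum_e \sum_f harm a e * Y' e f * harm b f.
have XL a b : \sum_c X a c * lap R (phi c) (phi b)
    = (a == b)%:R - \sum_e #|C|%:R^-1 * core e b.
  under eq_bigr do rewrite lapE.
  exact: (schur_ginv green_lap harm_lap Y'_inv harm1).
rewrite (degree_kirchhoff_reindex phi_bij XL).
under [X in X * _]eq_bigr do rewrite natr_degree_bicorona.
rewrite sum_degree /bicorona_kirchhoff !(natrD, natrM, natrX).
congr (_ * _ - _); first by rewrite /degC; ring.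
- have -> : \sum_a (degree (phi a))%:R * X a a
      = \sum_a deg a * green a a
        + \sum_e \sum_f Y' e f * \sum_a harm a e * (deg a * harm a f).
    transitivity (\sum_a (deg a * green a a
      + \sum_e \sum_f Y' e f * (harm a e * (deg a * harm a f)))).
      apply: eq_bigr => a _; rewrite natr_degree_bicorona mulrDr mulr_sumr.
      congr (_ + _); apply: eq_bigr => e _; rewrite mulr_sumr.
      by apply: eq_bigr => f _; ring.
    rewrite big_split /= exchange_big; congr (_ + _); apply: eq_bigr => e _.
    by rewrite exchange_big; apply: eq_bigr => f _; rewrite mulr_sumr.
  congr (_ + _).
    exact: trace_deg_green.
  under eq_bigr do under eq_bigr do rewrite sum_harm_deg_harm mulrDr.
  under eq_bigr do rewrite big_split /=.
  rewrite big_split /=.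
  have -> : \sum_c \sum_e Y' c e * ((degC + nK * (1 + rK%:R)) * (c == e)%:R)
      = (degC + nK * (1 + rK%:R)) * (\sum_c Y c c) / (1 + nH).
    rewrite mulr_sumr mulr_suml; apply: eq_bigr => c _.
    rewrite -(sum_delta c
      (fun e => (degC + nK * (1 + rK%:R)) * Y c e / (1 + nH))).
    by apply: eq_bigr => e _; rewrite /Y'; ring.
  have -> (b : R) : \sum_c \sum_e Y' c e * (b * N c e)
      = b / (1 + nH) * (\sum_c \sum_e Y c e * N c e).
    rewrite mulr_sumr; apply: eq_bigr => c _; rewrite mulr_sumr.
    by apply: eq_bigr => e _; rewrite /Y'; ring.
  by rewrite trace_YN /degC; field; rewrite k0 nH1.
(* The harmonic part of X contributes nothing to d X d^T, because d h is
   constant on C and Y kills constants. *)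
rewrite -form_deg_green; apply/eqP; rewrite -subr_eq0 -sumrB; apply/eqP.
transitivity (\sum_a \sum_e \sum_f
    deg a * (harm a e * Y' e f * \sum_b harm b f * deg b)).
  apply: eq_bigr => a _; rewrite mulr_sumr -sumrB.
  rewrite (eq_bigr (fun b => \sum_e \sum_f
      deg a * (harm a e * Y' e f * (harm b f * deg b)))).
    rewrite exchange_big; apply: eq_bigr => e _ /=.
    rewrite exchange_big; apply: eq_bigr => f _ /=.
    by rewrite !mulr_sumr.
  move=> b _; rewrite !natr_degree_bicorona /X.
  rewrite mulrDr mulrDl mulrA addrAC subrr add0r mulr_sumr mulr_suml.
  apply: eq_bigr => e _; rewrite mulr_sumr mulr_suml.
  by apply: eq_bigr => f _; ring.
apply: big1 => a _; apply: big1 => e _.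
pose q : R := degC + l%:R
  + (l%:R * nH * (k%:R + rH%:R) / k%:R + nK * (1 + rK%:R)).
rewrite (eq_bigr (fun f => Y e f * (deg a * harm a e / (1 + nH) * q))).
  by rewrite -mulr_suml Y_row mul0r.
by move=> f _; rewrite sum_deg_harm /Y' -/q; ring.
Qed.

End Bicorona.

(** * Incidence of vertices and edges *)

Section Incidence.
Variable G : sgraph.

Definition incident (v : G) (E : inserted G) : bool := v \in val E.

Lemma edgesP (E : {set G}) :
  reflect (exists x y, adj x y /\ E = [set x; y]) (E \in edges G).
Proof.
rewrite inE; apply: (iffP existsP).
  by case=> x /existsP[y /andP[xy /eqP->]]; exists x, y.
case=> x [y [xy ->]].
by exists x; apply/existsP; exists y; rewrite xy eqxx.
Qed.

Lemma card_ends (E : inserted G) : #|[set v | incident v E]| = 2.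
Proof.
have /edgesP[x [y [xy xyE]]] := valP E.
rewrite -(_ : [set x; y] = [set v | incident v E]); last first.
  by apply/setP=> v; rewrite inE /incident xyE.
by rewrite cards2; case: eqP xy => // ->; rewrite adj_irr.
Qed.

Lemma card_incident_edges (v : G) : #|[set E | incident v E]| = degree v.
Proof.
rewrite /degree -(card_in_imset (f := fun y => [set v; y])); last first.
  move=> y z; rewrite !inE => vy vz /setP /(_ y).
  rewrite !inE eqxx orbT; case: eqP vy => [->|_ _ /esym/eqP] //.
  by rewrite adj_irr.
rewrite -(card_imset _ val_inj); apply: eq_card => E; apply/imsetP/imsetP.
- case=> F; rewrite inE /incident => vF ->.
  have /edgesP[x [y [xy xyF]]] := valP F.
  move: vF; rewrite xyF !inE => /orP[] /eqP->; first by exists y; rewrite ?inE.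
  by exists x; rewrite ?inE 1?adj_sym // setUC.
- case=> y; rewrite inE => vy ->.
  have vyE : [set v; y] \in edges G by apply/edgesP; exists v, y.
  by exists (Sub [set v; y] vyE); rewrite ?SubK // inE /incident SubK !inE eqxx.
Qed.

Lemma card_common_edges (u v : G) : u != v ->
  #|[set E | incident u E && incident v E]| = adj u v.
Proof.
move=> uv; case uvA: (adj u v).
  have uvE : [set u; v] \in edges G by apply/edgesP; exists u, v.
  apply/eqP/cards1P; exists (Sub [set u; v] uvE); apply/setP=> E; rewrite !inE.
  apply/idP/eqP => [|->]; last by rewrite /incident SubK !inE !eqxx orbT.
  move=> /andP[uE vE]; apply: val_inj; rewrite SubK; apply/esym/eqP.
  have /eqP : #|val E| = 2.
    by rewrite -(card_ends E); apply: eq_card => w; rewrite inE.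
  rewrite eqEcard => /eqP ->; rewrite cards2 uv /= andbT.
  by apply/subsetP=> w; rewrite !inE => /orP[] /eqP->.
apply/eqP; rewrite cards_eq0; apply/eqP/setP=> E; rewrite !inE; apply/negP.
have /edgesP[x [y [xy xyE]]] := valP E.
rewrite /incident xyE !inE => /andP[] /orP[] /eqP ux /orP[] /eqP vy.
- by rewrite ux vy eqxx in uv.
- by rewrite ux vy xy in uvA.
- by rewrite ux vy adj_sym xy in uvA.
- by rewrite ux vy eqxx in uv.
Qed.

Variable R : rcfType.
Let inc (v : G) (E : inserted G) : R := (incident v E)%:R.

(** The signless Laplacian D + A = B B^T, written as 2 D - L. *)
Lemma common_vertices (u v : G) :
  common R incident u v = 2 * (degree u)%:R * (u == v)%:R - lap R u v.
Proof.
rewrite /common /lap; under eq_bigr do rewrite -natrM mulnb.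
rewrite sum_pred; have [<-|uv] := eqVneq u v; last first.
  by rewrite card_common_edges // !mulr0 !sub0r opprK.
rewrite adj_irr -card_incident_edges.
by under eq_finset do rewrite andbb; rewrite !mulr1 subr0; ring.
Qed.

Variable r : nat.
Hypothesis reg : regular G r.

Lemma sum_ends E : \sum_v inc v E = 2.
Proof.
by rewrite sum_pred card_ends.
Qed.

Lemma sum_incident_edges v : \sum_E inc v E = r%:R.
Proof.
by rewrite -(reg v) -card_incident_edges -sum_pred.
Qed.

Lemma card_inserted : #|inserted G| = #|edges G|.
Proof. by rewrite card_sig; apply: eq_card => E; rewrite inE. Qed.

Lemma handshake : (2 * #|edges G| = #|G| * r)%N.
Proof.
have cardE (T : finType) (P : pred T) : #|[set x | P x]| = (\sum_x P x)%N.
  rewrite -sum1_card big_mkcond; apply: eq_bigr => x _.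
  by rewrite inE; case: (P x).
transitivity (\sum_(E : inserted G) \sum_v incident v E)%N.
  rewrite (eq_bigr (fun=> 2)) => [|E _]; last by rewrite -cardE card_ends.
  by rewrite sum_nat_const card_inserted mulnC.
rewrite exchange_big (eq_bigr (fun=> r)) ?sum_nat_const // => v _.
by rewrite -cardE card_incident_edges reg.
Qed.

(** * Generalised inverses for the two sides of the subdivision graph *)

Hypothesis r_gt0 : (0 < r)%N.
Hypothesis G_gt0 : (0 < #|G|)%N.
Variable Z : G -> G -> R.
Hypothesis Z_inv :
  forall x y, \sum_z Z x z * lap R z y = (x == y)%:R - #|G|%:R^-1.
Hypothesis Z_row : forall x, \sum_y Z x y = 0.

(** On the vertex side N = B B^T = 2 r - L, hence r - N / 2 = L / 2. *)
Lemma vertex_side_inverse (Y := fun u v => 2 * Z u v) :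
  (forall u v,
     \sum_w Y u w * (r%:R * (w == v)%:R - common R incident w v / 2%:R)
     = (u == v)%:R - #|G|%:R^-1)
  /\ (forall u, \sum_w Y u w = 0).
Proof.
split=> u => [v|]; last by rewrite -mulr_sumr Z_row mulr0.
rewrite -Z_inv; apply: eq_bigr => w _; rewrite common_vertices reg /Y.
by field.
Qed.

Let ZB u F : R := \sum_v Z u v * inc v F.

(** On the edge side S = 2 - B^T B / r.  Since Z L = 1 - J / n and
B B^T = 2 r - L, the product B^T Z B S equals B^T Z L B / r, that is,
B^T B / r up to a multiple of J; so (1 + B^T Z B) S / 2 is 1 up to a multiple
of J, and the last term of Y makes its row sums vanish. *)
Lemma edge_side_inverse
    (Y := fun E F => 2^-1 *
       ((E == F)%:R + \sum_u inc u E * ZB u F - #|edges G|%:R^-1)) :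
  [/\ forall E F, \sum_D Y E D * (2%:R * (D == F)%:R
         - common R (fun D v => incident v D) D F / r%:R)
       = (E == F)%:R - #|inserted G|%:R^-1,
      forall E, \sum_F Y E F = 0
    & \sum_E Y E E = (#|edges G|%:R - #|G|%:R) / 2 + r%:R * \sum_u Z u u].
Proof.
pose S D F : R :=
  2%:R * (D == F)%:R - common R (fun D v => incident v D) D F / r%:R.
have r0 : r%:R != 0 :> R by rewrite pnatr_eq0 -lt0n.
have n0 : #|G|%:R != 0 :> R by rewrite pnatr_eq0 -lt0n.
have mE : #|edges G|%:R = #|G|%:R * r%:R / 2 :> R.
  by rewrite -natrM -handshake natrM; field.
have NE D F :
    common R (fun D v => incident v D) D F = \sum_v inc v D * inc v F by [].
have ZB1 u : \sum_F ZB u F = 0.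
  rewrite exchange_big; under eq_bigr do rewrite -mulr_sumr sum_incident_edges.
  by rewrite -mulr_suml Z_row mul0r.
have BZB1 E : \sum_F \sum_u inc u E * ZB u F = 0.
  by rewrite exchange_big big1 // => u _; rewrite -mulr_sumr ZB1 mulr0.
have ZN u w : \sum_v Z u v * common R incident v w
    = 2 * r%:R * Z u w - ((u == w)%:R - #|G|%:R^-1).
  rewrite -Z_inv -(sum_delta w (fun v => 2 * r%:R * Z u v)) -sumrB.
  by apply: eq_bigr => v _; rewrite common_vertices reg eq_sym; ring.
split.
- move=> E F; transitivity (\sum_D Y E D * S D F); first by [].
  have N1 : \sum_D S D F = 0.
    rewrite /S sumrB -mulr_sumr -mulr_suml; under eq_bigr do rewrite eq_sym.
    rewrite sum_delta1 exchange_big /=.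
    under eq_bigr do rewrite -mulr_suml sum_incident_edges.
    by rewrite -mulr_sumr sum_ends; field.
  (* Z B (2 - B^T B / r) = Z (2 r - B B^T) B / r = Z L B / r. *)
  have ZBS u : \sum_D ZB u D * S D F
      = r%:R^-1 * (inc u F - 2 / #|G|%:R).
    transitivity (2 * ZB u F
        - r%:R^-1 * \sum_w (\sum_v Z u v * common R incident v w) * inc w F).
      rewrite -(sum_delta F (fun D => ZB u D)) mulr_sumr.
      have -> : \sum_w (\sum_v Z u v * common R incident v w) * inc w F
          = \sum_D ZB u D * common R (fun D v => incident v D) D F.
        transitivity (\sum_w \sum_v \sum_D Z u v * inc v D * inc w D * inc w F).
          apply: eq_bigr => w _; rewrite mulr_suml; apply: eq_bigr => v _.
          rewrite mulr_sumr mulr_suml; apply: eq_bigr => D _.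
          by rewrite -/(inc v D) -/(inc w D) mulrA.
        under eq_bigr do rewrite exchange_big.
        rewrite exchange_big; apply: eq_bigr => D _; rewrite mulr_sumr.
        apply: eq_bigr => w _; rewrite -/(inc w D) -/(inc w F) mulrA.
        by rewrite mulr_suml mulr_suml.
      rewrite mulr_sumr -sumrB.
      by apply: eq_bigr => D _; rewrite /S eq_sym; ring.
    under eq_bigr do rewrite ZN !mulrBl -[_ * Z u _ * _]mulrA.
    rewrite !sumrB -!mulr_sumr sum_delta sum_ends -/(ZB u F).
    by field; rewrite r0 n0.
  (* The three summands of Y, applied to S one by one. *)
  transitivity (2^-1 * (\sum_D (E == D)%:R * S D F
      + \sum_u inc u E * (r%:R^-1 * (inc u F - 2 / #|G|%:R))
      - #|edges G|%:R^-1 * \sum_D S D F)).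
    under [X in _ + X - _]eq_bigr do rewrite -ZBS mulr_sumr.
    rewrite exchange_big mulr_sumr /= -big_split -sumrB mulr_sumr /=.
    apply: eq_bigr => D _; rewrite /Y.
    have -> : \sum_u inc u E * (ZB u D * S D F)
        = (\sum_u inc u E * ZB u D) * S D F.
      by rewrite mulr_suml; apply: eq_bigr => u _; rewrite mulrA.
    ring.
  rewrite N1 sum_delta {1}/S NE mulr0 subr0.
  have -> : \sum_u inc u E * (r%:R^-1 * (inc u F - 2 / #|G|%:R))
      = r%:R^-1 * (\sum_v inc v E * inc v F - 4 / #|G|%:R).
    rewrite -[4](_ : 2 * \sum_u inc u E = 4); last by rewrite sum_ends; ring.
    rewrite mulr_sumr mulr_suml -sumrB mulr_sumr.
    by apply: eq_bigr => u _; ring.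
  by rewrite card_inserted mE; field; rewrite r0 n0.
- move=> E; rewrite -mulr_sumr sumrB big_split /= sum_delta1 BZB1 sum_cst.
  rewrite card_inserted.
  by rewrite mE; field; rewrite r0 n0.
rewrite -mulr_sumr sumrB big_split /=.
have -> : \sum_E \sum_u inc u E * ZB u E
    = \sum_u (2 * r%:R * Z u u - (1 - #|G|%:R^-1)).
  rewrite exchange_big; apply: eq_bigr => u _.
  have := ZN u u; rewrite eqxx => <-.
  under eq_bigr do rewrite mulr_sumr.
  rewrite exchange_big; apply: eq_bigr => v _; rewrite mulr_sumr.
  by apply: eq_bigr => E _; rewrite -/(inc u E) -/(inc v E); ring.
under eq_bigr do rewrite eqxx mulr1n.
rewrite sumrB -mulr_sumr !sum_cst card_inserted mE.
by field; rewrite r0 n0.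
Qed.

End Incidence.

(** * The two coronas *)

Section Coronas.
Variables (R : rcfType) (G1 G2 G3 : sgraph) (r1 r2 r3 : nat).
Variables (theta mu eta : seq R).
Hypotheses (reg1 : regular G1 r1) (reg2 : regular G2 r2) (reg3 : regular G3 r3).
Hypotheses (conn1 : connected G1) (r1_gt0 : (0 < r1)%N).
Hypotheses (G1_gt0 : (0 < #|G1|)%N) (G2_gt0 : (0 < #|G2|)%N).
Hypothesis G3_gt0 : (0 < #|G3|)%N.
Hypothesis theta_spec : spectrum_of (normalized_laplacian R G1) theta.
Hypothesis mu_spec : spectrum_of (normalized_laplacian R G2) mu.
Hypothesis eta_spec : spectrum_of (normalized_laplacian R G3) eta.

Let resolvent_mu (k : nat) := \sum_(j < #|G2|.-1) (k%:R + r2%:R * mu`_j)^-1.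
Let resolvent_eta := \sum_(j < #|G3|.-1) (1 + r3%:R * eta`_j)^-1.
Let resolvent_theta := \sum_(i < #|G1|.-1) (r1%:R * theta`_i)^-1.

Lemma degree_kirchhoff_vertex_corona :
  degree_kirchhoff R (vertex_corona G1 G2 G3)
    = bicorona_kirchhoff #|edges G1| #|G1| #|G2| #|G3| r1 2 r2 r3
        (resolvent_mu r1 + r1%:R^-1) (resolvent_eta + 1^-1)
        ((#|edges G1|%:R - #|G1|%:R) / 2 + r1%:R * resolvent_theta).
Proof.
have r1_gt0R : 0 < r1%:R :> R by rewrite ltr0n.
have [GH [GH_inv GH_row GH_tr]] := green_kernel reg2 mu_spec G2_gt0 r1_gt0R.
have [GK [GK_inv GK_row GK_tr]] := green_kernel reg3 eta_spec G3_gt0 (@ltr01 R).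
have [Z [Z_inv Z_row _ Z_tr]] :=
  pseudo_inverse_kernel reg1 theta_spec G1_gt0 conn1 r1_gt0.
have [Y_inv Y_row Y_tr] := edge_side_inverse reg1 r1_gt0 G1_gt0 Z_inv Z_row.
pose swap (s : inserted G1 + G1) :=
  match s with inl E => inr E | inr v => inl v end.
pose unswap (s : G1 + inserted G1) :=
  match s with inl v => inr v | inr E => inl E end.
pose phi (a : bicorona_vertex (inserted G1) G1 G2 G3) :
    vertex_corona G1 G2 G3 :=
  match a with inl s => inl (swap s) | inr p => inr p end.
have phi_bij : bijective phi.
  exists (fun b : vertex_corona G1 G2 G3 =>
    match b with inl s => inl (unswap s) | inr p => inr p end).
    by case=> [[E|v]|p].
  by case=> [[v|E]|p].
have phi_adj a b : adj (phi a) (phi b)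
    = bicorona_adj (fun E v => incident v E) a b.
  case: a b => [[E|v]|[[v x]|[E x]]] [[F|u]|[[u y]|[F y]]] //=.
  all: rewrite ?inE /= //.
have inc_r1 (v : G1) : #|[set E | incident v E]| = r1
  by rewrite card_incident_edges; exact: reg1.
have E_gt0 : (0 < #|inserted G1|)%N.
  rewrite card_inserted -(ltn_pmul2l (isT : 0 < 2)%N) (handshake reg1).
  by rewrite muln0 muln_gt0 G1_gt0.
rewrite (degree_kirchhoff_bicorona phi_bij phi_adj r1_gt0 inc_r1
  (@card_ends G1) reg2 reg3 GH_inv GH_row GK_inv GK_row Y_inv Y_row E_gt0).
by rewrite GH_tr GK_tr Y_tr Z_tr card_inserted.
Qed.

Lemma degree_kirchhoff_edge_corona :
  degree_kirchhoff R (edge_corona G1 G2 G3)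
    = bicorona_kirchhoff #|G1| #|edges G1| #|G2| #|G3| 2 r1 r2 r3
        (resolvent_mu 2 + 2^-1) (resolvent_eta + 1^-1) (2 * resolvent_theta).
Proof.
have [GH [GH_inv GH_row GH_tr]] :=
  green_kernel reg2 mu_spec G2_gt0 (@ltr0Sn R 1).
have [GK [GK_inv GK_row GK_tr]] := green_kernel reg3 eta_spec G3_gt0 (@ltr01 R).
have [Z [Z_inv Z_row _ Z_tr]] :=
  pseudo_inverse_kernel reg1 theta_spec G1_gt0 conn1 r1_gt0.
have [Y_inv Y_row] := vertex_side_inverse reg1 Z_inv Z_row.
pose phi (a : bicorona_vertex G1 (inserted G1) G2 G3) :
  edge_corona G1 G2 G3 := a.
have phi_bij : bijective phi by exists id.
have phi_adj a b : adj (phi a) (phi b) = bicorona_adj (@incident G1) a b.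
  case: a b => [[v|E]|[[E x]|[v x]]] [[u|F]|[[F y]|[u y]]] //=.
  all: rewrite ?inE /= //.
have inc_r1 (v : G1) : #|[set E | incident v E]| = r1
  by rewrite card_incident_edges; exact: reg1.
rewrite (degree_kirchhoff_bicorona phi_bij phi_adj (isT : 0 < 2)%N
  (@card_ends G1) inc_r1 reg2 reg3 GH_inv GH_row GK_inv GK_row
  Y_inv Y_row G1_gt0).
by rewrite GH_tr GK_tr -mulr_sumr Z_tr card_inserted.
Qed.

End Coronas.

(** Each summand is affine in 1 / s_i; the nonvanishing of the s_i is needed
because x / 0 = 0. *)
Lemma sum_affine_inv (R : rcfType) (n r : nat) (s : seq R) (a b c : R) :
    (0 < n)%N -> (0 < r)%N -> c != 0 ->
    (forall i, (i < n.-1)%N -> s`_i != 0) ->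
  \sum_(i < n.-1) (a - (2 - s`_i) * b) / (c * s`_i)
    = (a - 2 * b) * r%:R / c * (\sum_(i < n.-1) (r%:R * s`_i)^-1)
      + (n%:R - 1) * b / c.
Proof.
move=> n_gt0 r_gt0 c0 s0; have r0 : r%:R != 0 :> R by rewrite pnatr_eq0 -lt0n.
have -> : (n%:R - 1) * b / c = \sum_(i < n.-1) b / c.
  by rewrite sum_cst card_ord -subn1 natrB // mulrA.
rewrite mulr_sumr -big_split; apply: eq_bigr => i _ /=.
by field; rewrite r0 c0 s0.
Qed.

Theorem theorem4p3 (R : rcfType) (G1 G2 G3 : sgraph)
    (n1 n2 n3 m1 m2 m3 r1 r2 r3 : nat)
    (theta mu eta : seq R)
    (hn1 : #|G1| = n1) (hn2 : #|G2| = n2) (hn3 : #|G3| = n3)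
    (n1_gt0 : (1 <= n1)%N) (n2_gt0 : (1 <= n2)%N) (n3_gt0 : (1 <= n3)%N)
    (hm1 : #|edges G1| = m1) (hm2 : #|edges G2| = m2) (hm3 : #|edges G3| = m3)
    (reg1 : regular G1 r1) (reg2 : regular G2 r2) (reg3 : regular G3 r3)
    (conn1 : connected G1) (r1_gt0 : (1 <= r1)%N)
    (htheta : spectrum_of (normalized_laplacian R G1) theta)
    (hmu : spectrum_of (normalized_laplacian R G2) mu)
    (heta : spectrum_of (normalized_laplacian R G3) eta) :
  degree_kirchhoff R (vertex_corona G1 G2 G3) =
    2 * (2 * m1 + n1 * m2 + m1 * m3 + 2 * m1 * n2 + m1 * n3)%:R *
    (\sum_(j < n2.-1) (n1 * (r1 + r2))%:R / (r1%:R + r2%:R * mu`_j)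
     + \sum_(k < n3.-1) (m1 * (r3 + 1))%:R / (1 + r3%:R * eta`_k)
     + (m1%:R - n1%:R) * (r3 + 2)%:R * (2 * n2 + n3 + 2)%:R / (2 * n2 + 2)%:R
     + (((2 * n2 + n3 + 2) * (6 * r1 + 3 * r2 + 3 * r1 * r3 + r2 * r3))%:R
        - (n3 * (r1 + r2))%:R
        - (2 * (r3 + 1) * (r1 + r2 + r1 * n2))%:R)
       / (((4 * r1 + r2 + r1 * r3) * (2 * n2 + n3 + 2))%:R
          - (2 * r1 * n3 + r2 * n3 + 2 * r2)%:R
          - ((2 + 2 * n2) * (2 * r1 + r1 * r3))%:R)
     + \sum_(i < n1.-1)
         (((4 * r1 + r2 + r1 * r3) * (2 * n2 + n3 + 2))%:R
          - (n3 * (2 * r1 + r2))%:R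
          - (2 - theta`_i) * ((1 + n2) * (2 * r1 + r1 * r3) + r2)%:R)
         / ((r1 * (1 + n2))%:R * theta`_i))
  /\
  degree_kirchhoff R (edge_corona G1 G2 G3) =
    2 * (2 * m1 + m1 * m2 + n1 * m3 + n1 * n3 + 2 * m1 * n2)%:R *
    (\sum_(j < n2.-1) (m1 * (r2 + 2))%:R / (2 + r2%:R * mu`_j)
     + \sum_(k < n3.-1) (n1 * (r3 + 1))%:R / (1 + r3%:R * eta`_k)
     + (r2 + 4)%:R * (m1%:R - n1%:R) / 2
     + ((2 * (r1 * n2 + r1 + n3) * (r2 * r3 + 6 * r3 + 3 * r2 + 12))%:R
        - (n3 * (2 * r2 + 4))%:R
        - (2 * r1 * (r3 + 1) * (2 * n2 + r2 + 2))%:R)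
       / (2 * n2 * r1 * r2 + 8 * n2 * r1 + 4 * n3 * r3 + 8 * n3 + 8 * r1)%:R
     + \sum_(i < n1.-1)
         ((2 * (r1 * n2 + r1 + n3) * (2 * r3 + r2 + 8))%:R
          - (2 * r2 * n3 + 8 * n3)%:R
          - r1%:R * (2 - theta`_i) * ((2 + 2 * n2) * (2 + r3) + r2)%:R)
         / ((r1 * (2 + 2 * n2))%:R * theta`_i)).
Proof.
have n1_gt0' : (0 < #|G1|)%N by rewrite hn1.
have n2_gt0' : (0 < #|G2|)%N by rewrite hn2.
have n3_gt0' : (0 < #|G3|)%N by rewrite hn3.
have [_ [_ _ theta0 _]] :=
  pseudo_inverse_kernel reg1 htheta n1_gt0' conn1 r1_gt0.
rewrite hn1 in theta0.
have h1 : m1%:R = n1%:R * r1%:R / 2 :> R.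
  by rewrite -natrM -hn1 -(handshake reg1) hm1 natrM; field.
have h2 : m2%:R = n2%:R * r2%:R / 2 :> R.
  by rewrite -natrM -hn2 -(handshake reg2) hm2 natrM; field.
have h3 : m3%:R = n3%:R * r3%:R / 2 :> R.
  by rewrite -natrM -hn3 -(handshake reg3) hm3 natrM; field.
have p1 : 0 < n1%:R :> R by rewrite ltr0n.
have p2 : 0 < n2%:R :> R by rewrite ltr0n.
have p3 : 0 < n3%:R :> R by rewrite ltr0n.
have q1 : 0 < r1%:R :> R by rewrite ltr0n.
have q2 : 0 <= r2%:R :> R by apply: ler0n.
have q3 : 0 <= r3%:R :> R by apply: ler0n.
split.
- rewrite (degree_kirchhoff_vertex_corona reg1 reg2 reg3 conn1 r1_gt0
    n1_gt0' n2_gt0' n3_gt0' htheta hmu heta) hn1 hn2 hn3 hm1.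
  rewrite (sum_affine_inv _ _ n1_gt0 r1_gt0 _ theta0); last first.
    by rewrite pnatr_eq0 -lt0n muln_gt0 r1_gt0.
  rewrite -!mulr_sumr.
  rewrite /bicorona_kirchhoff invr1 -mulnn.
  set M := \sum_(j < _) (r1%:R + _)^-1; set E := \sum_(j < _) (1 + _)^-1.
  set T := \sum_(j < _) (r1%:R * _)^-1.
  rewrite !(natrD, natrM) h1 h2 h3.
  move: n1%:R n2%:R n3%:R r1%:R r2%:R r3%:R p1 p2 p3 q1 q2 q3 M E T.
  move=> x1 x2 x3 y1 y2 y3 p1 p2 p3 q1 q2 q3 M E T.
  field; apply/and4P; split; try by apply: lt0r_neq0; lra.
  (* This denominator is 4 y1 x2 + 2 y1 x3 + 4 y1 + 2 y2 x2 + y1 y3 x3. *)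
  apply: lt0r_neq0.
  have := mulr_ge0 (mulr_ge0 (ltW q1) q3) (ltW p3).
  have := mulr_ge0 (ltW q1) (ltW p2); have := mulr_ge0 (ltW q1) (ltW p3).
  have := mulr_ge0 q2 (ltW p2).
  by lra.
rewrite (degree_kirchhoff_edge_corona reg1 reg2 reg3 conn1 r1_gt0
  n1_gt0' n2_gt0' n3_gt0' htheta hmu heta) hn1 hn2 hn3 hm1.
under [X in _ = _ * (_ + X)]eq_bigr do rewrite -mulrA [r1%:R * _]mulrCA.
rewrite (sum_affine_inv _ _ n1_gt0 r1_gt0 _ theta0); last first.
  by rewrite pnatr_eq0 -lt0n muln_gt0 r1_gt0.
rewrite -!mulr_sumr.
rewrite /bicorona_kirchhoff invr1 -mulnn.
set M := \sum_(j < _) (2 + _)^-1; set E := \sum_(j < _) (1 + _)^-1.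
set T := \sum_(j < _) (r1%:R * _)^-1.
rewrite !(natrD, natrM) h1 h2 h3.
move: n1%:R n2%:R n3%:R r1%:R r2%:R r3%:R p1 p2 p3 q1 q2 q3 M E T.
move=> x1 x2 x3 y1 y2 y3 p1 p2 p3 q1 q2 q3 M E T.
field; apply/and4P; split; try by apply: lt0r_neq0; lra.
apply: lt0r_neq0.
have := mulr_ge0 (mulr_ge0 (ltW p2) (ltW q1)) q2.
have := mulr_ge0 (ltW p2) (ltW q1); have := mulr_ge0 (ltW p3) q3.
by lra.
Qed.
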